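(* Let $\mathbb{k}$ be a field and let $G$ be a finitely generated group. If $G$ is central-by-finite (i.e. its center has finite index in $G$), then the group algebra satisfies $\operatorname{io}(\mathbb{k}[G])=1$.
   Context: For a noetherian Hopf algebra $H$ that is AS-Gorenstein of dimension $d$ (i.e. $\operatorname{inj.dim}{}_HH=\operatorname{inj.dim}H_H=d$ and $\operatorname{Ext}^i_H(\mathbb{k},H)$, $\operatorname{Ext}^i_{H^{op}}(\mathbb{k},H)$ vanish for $i\neq d$ and are one-dimensional for $i=d$), the left homological integral space is the one-dimensional $H$-$H$-bimodule $\int_H^l=\operatorname{Ext}^d_H(\mathbb{k},H)$, and the integral order $\operatorname{io}(H)$ is the least $n\ge1$ such that $(\int_H^l)^{\otimes n}\cong\mathbb{k}$ (trivial bimodule) as $H$-$H$-bimodules, or $+\infty$ if there is none. Every noetherian affine PI Hopf algebra is known to be AS-Gorenstein; in particular this applies to $\mathbb{k}[G]$ for $G$ as in the claim. *)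

(* Defs.v *)
From HB Require Import structures.
From mathcomp Require Import all_boot all_algebra.
From mathcomp Require Import finmap.
From mathcomp.classical Require Import boolp functions.
From mathcomp.multinomials Require Import monalg.

Set Implicit Arguments.
Unset Strict Implicit.
Unset Printing Implicit Defensive.

Import GRing.Theory.
Local Open Scope ring_scope.

(* Submodules and quotient modules. Membership is an arbitrary proposition,   *)
(* so both constructions rely on classical logic.                             *)

Record submodule (R : pzRingType) (V : lmodType R) := Submodule {
  smem :> V -> Prop;
  smem0 : smem 0;
  smemP : forall a u v, smem u -> smem v -> smem (a *: u + v) }.

Section SubQuotient.
Variables (R : pzRingType) (V : lmodType R) (S : submodule V).

Definition smemb : {pred V} := fun x => `[< S x >].

Fact smemb_submod_closed : submod_closed smemb.
Proof.
split; first by apply/asboolP; exact: smem0.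
by move=> a u v /asboolP Su /asboolP Sv; apply/asboolP; exact: smemP.
Qed.
HB.instance Definition _ :=
  GRing.isSubmodClosed.Build R V smemb smemb_submod_closed.

Definition subm : Type := {x : V | smemb x}.
HB.instance Definition _ := SubType.on subm.
HB.instance Definition _ := [Choice of subm by <:].
HB.instance Definition _ := [SubChoice_isSubLmodule of subm by <:].

Definition Subm (x : V) (Sx : S x) : subm :=
  exist _ x (introT (asboolP (S x)) Sx).

Lemma submP (x : subm) : S (val x).
Proof. exact/asboolP/(valP x). Qed.

Definition quotm : Type := Quotient.quot smemb.
HB.instance Definition _ := GRing.Zmodule.on quotm.

Definition quot_pi (x : V) : quotm := (\pi_(Quotient.quot smemb) x)%qT.
Definition quot_repr (x : quotm) : V := (repr (x : Quotient.quot smemb))%qT.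

Lemma quot_reprK : cancel quot_repr quot_pi.
Proof. by move=> x; exact: reprK. Qed.

Lemma quot_piP x y : quot_pi x = quot_pi y <-> S (x - y).
Proof.
split=> [h|h].
  have : x - y \in smemb by rewrite Quotient.idealrBE; apply/eqP.
  by rewrite unfold_in => /asboolP.
by apply/eqP; rewrite /quot_pi -Quotient.idealrBE unfold_in; apply/asboolP.
Qed.

Lemma smemD x y : S x -> S y -> S (x + y).
Proof. by move=> Sx Sy; rewrite -[x]scale1r; apply: smemP. Qed.

Lemma smemZ a x : S x -> S (a *: x).
Proof. by move=> Sx; rewrite -[_ *: _]addr0; apply: smemP => //; exact: smem0. Qed.

Lemma smemN x : S x -> S (- x).
Proof. by move=> Sx; rewrite -scaleN1r; exact: smemZ. Qed.

Lemma quot_piD x y : quot_pi (x + y) = quot_pi x + quot_pi y.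
Proof. exact: Quotient.pi_add. Qed.

Lemma quot_repr_pi x : S (quot_repr (quot_pi x) - x).
Proof. by apply/quot_piP; rewrite quot_reprK. Qed.

Definition quot_scale (a : R) (x : quotm) : quotm :=
  quot_pi (a *: quot_repr x).

Lemma quot_piZ a x : quot_pi (a *: x) = quot_scale a (quot_pi x).
Proof.
apply/quot_piP; rewrite -scalerBr; apply: smemZ.
by rewrite -opprB; apply/smemN/quot_repr_pi.
Qed.

Lemma quot_ind (P : quotm -> Prop) : (forall x, P (quot_pi x)) -> forall x, P x.
Proof. by move=> h x; rewrite -[x]quot_reprK. Qed.

Fact quot_scaleA a b x : quot_scale a (quot_scale b x) = quot_scale (a * b) x.
Proof. by elim/quot_ind: x => x; rewrite -!quot_piZ scalerA. Qed.
Fact quot_scale1 : left_id 1 quot_scale.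
Proof. by elim/quot_ind => x; rewrite -quot_piZ scale1r. Qed.
Fact quot_scaleDr : right_distributive quot_scale +%R.
Proof.
move=> a; elim/quot_ind => x; elim/quot_ind => y.
by rewrite -!quot_piZ -!quot_piD -quot_piZ scalerDr.
Qed.
Fact quot_scaleDl x : {morph quot_scale^~ x : a b / a + b}.
Proof.
by elim/quot_ind: x => x a b; rewrite -!quot_piZ -!quot_piD scalerDl.
Qed.
HB.instance Definition _ := GRing.Zmodule_isLmodule.Build R quotm
  quot_scaleA quot_scale1 quot_scaleDr quot_scaleDl.

Fact quot_pi_linear : linear quot_pi.
Proof. by move=> a x y; rewrite quot_piD quot_piZ. Qed.
HB.instance Definition _ := GRing.isLinear.Build R V quotm _ quot_pi quot_pi_linear.

End SubQuotient.

Section Free.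
Variables (R : nzRingType) (K : choiceType) (V : lmodType R).

(* The linear extension to the free module {malg R[K]} of a map on its basis. *)
Definition flift (h : K -> V) (g : {malg R[K]}) : V :=
  \sum_(k <- msupp g) g@_k *: h k.

Lemma fliftEw h (d : {fset K}) (g : {malg R[K]}) : (msupp g `<=` d)%fset ->
  flift h g = \sum_(k <- d) g@_k *: h k.
Proof.
move=> le; rewrite [LHS](big_fset_incl _ le) => //= x xd /mcoeff_outdom ->.
by rewrite scale0r.
Qed.

Fact flift_linear h : linear (flift h).
Proof.
move=> a g1 g2.
pose d := (msupp g1 `|` msupp g2)%fset.
have s1 : (msupp g1 `<=` d)%fset by exact: fsubsetUl.
have s2 : (msupp g2 `<=` d)%fset by exact: fsubsetUr.
have s : (msupp (a *: g1 + g2) `<=` d)%fset.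
  apply: fsubset_trans (msuppD_le _ _) _.
  by rewrite fsubUset s2 andbT (fsubset_trans (msuppZ_le _ _)).
rewrite (fliftEw _ s) (fliftEw _ s1) (fliftEw _ s2) scaler_sumr -big_split /=.
by apply: eq_bigr => k _; rewrite mcoeffD mcoeffZ scalerDl scalerA.
Qed.
HB.instance Definition _ h :=
  GRing.isLinear.Build R {malg R[K]} V _ (flift h) (flift_linear h).

Lemma fliftU h c k : flift h << c *g k >> = c *: h k.
Proof.
by rewrite (fliftEw _ (@msuppU_le _ _ k c)) big_seq_fset1 mcoeffUU.
Qed.

Lemma malgUZ c k : << c *g k >> = c *: << k >> :> {malg R[K]}.
Proof. by apply/malgP => x; rewrite mcoeffZ !mcoeffU mulrnAr mulr1. Qed.

Lemma free_ext (f g : {linear {malg R[K]} -> V}) :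
  (forall k, f << k >> = g << k >>) -> f =1 g.
Proof.
move=> fg x; rewrite [x]monalgE !linear_sum; apply: eq_bigr => k _.
by rewrite malgUZ !linearZ fg.
Qed.

End Free.

Section Homological.
Variable R : nzRingType.

Definition projective_module (P : lmodType R) : Prop :=
  forall (A B : lmodType R) (f : {linear A -> B}) (g : {linear P -> B}),
    (forall b, exists a, f a = b) ->
    exists h : {linear P -> A}, forall x, f (h x) = g x.

Definition injective_module (I : lmodType R) : Prop :=
  forall (A B : lmodType R) (f : {linear A -> B}) (g : {linear A -> I}),
    injective f ->
    exists h : {linear B -> I}, forall x, h (f x) = g x.

Record projective_resolution (M : lmodType R) := ProjectiveResolution {
  pr_mod :> nat -> lmodType R;
  pr_d : forall n, {linear pr_mod n.+1 -> pr_mod n};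
  pr_aug : {linear pr_mod 0 -> M};
  pr_projective : forall n, projective_module (pr_mod n);
  pr_surj : forall x, exists y, pr_aug y = x;
  pr_exact0 : forall x, pr_aug x = 0 <-> exists y, pr_d 0 y = x;
  pr_exact : forall n x, pr_d n x = 0 <-> exists y, pr_d n.+1 y = x }.

Record injective_resolution (M : lmodType R) := InjectiveResolution {
  ir_mod :> nat -> lmodType R;
  ir_d : forall n, {linear ir_mod n -> ir_mod n.+1};
  ir_aug : {linear M -> ir_mod 0};
  ir_injective : forall n, injective_module (ir_mod n);
  ir_inj : injective ir_aug;
  ir_exact0 : forall x, ir_d 0 x = 0 <-> exists y, ir_aug y = x;
  ir_exact : forall n x, ir_d n.+1 x = 0 <-> exists y, ir_d n y = x }.

Definition inj_dim_le (M : lmodType R) (d : nat) : Prop :=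
  exists J : injective_resolution M, forall n, (d < n)%N -> forall x : J n, x = 0.

Definition inj_dim_is (M : lmodType R) (d : nat) : Prop :=
  inj_dim_le M d /\ forall n, inj_dim_le M n -> (d <= n)%N.

Lemma free_projective (K : choiceType) : projective_module {malg R[K]}.
Proof.
move=> A B f g fsurj.
have [s sP] := choice (fun k : K => fsurj (g << k >>)).
exists (flift s) => x.
apply: (free_ext (f := f \o flift s)) => k /=.
by rewrite fliftU scale1r.
Qed.

Section Kernel.
Variables (M N : lmodType R) (f : {linear M -> N}).
Fact ker0 : f 0 = 0. Proof. exact: linear0. Qed.
Fact kerP a u v : f u = 0 -> f v = 0 -> f (a *: u + v) = 0.
Proof. by rewrite linearP => -> ->; rewrite scaler0 addr0. Qed.
Definition ker : submodule M := Submodule ker0 kerP.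
End Kernel.

Section FreeResolution.
Variable M : lmodType R.

(* The free module on the underlying set of a module, and its syzygies.       *)
Definition cover (N : lmodType R) : lmodType R := {malg R[N]}.
Definition cover_map (N : lmodType R) : {linear cover N -> N} := flift id.

Fixpoint syzygy (n : nat) : lmodType R :=
  if n is m.+1 then subm (ker (cover_map (syzygy m))) else M.

Definition fr_d n : {linear cover (syzygy n.+1) -> cover (syzygy n)} :=
  (val : {linear subm (ker (cover_map (syzygy n))) -> cover (syzygy n)})
    \o cover_map (syzygy n.+1).

Lemma cover_surj (N : lmodType R) x : exists y, cover_map N y = x.
Proof. by exists << x >>; rewrite /cover_map /= fliftU scale1r. Qed.

Lemma fr_exact_aux n x : cover_map (syzygy n) x = 0 <-> exists y, fr_d n y = x.
Proof.
split=> [h|[y <-]]; last exact: (submP (cover_map (syzygy n.+1) y)).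
have [y yx] := cover_surj (Subm (h : ker (cover_map (syzygy n)) x)).
by exists y; rewrite /fr_d /= yx.
Qed.

Lemma fr_exact n x : fr_d n x = 0 <-> exists y, fr_d n.+1 y = x.
Proof.
rewrite -fr_exact_aux; split=> h; last by rewrite /fr_d /= h.
exact: val_inj.
Qed.

Definition free_resolution : projective_resolution M :=
  @ProjectiveResolution M (fun n => cover (syzygy n)) fr_d (cover_map M)
    (fun n => @free_projective _) (@cover_surj M) (@fr_exact_aux 0) fr_exact.

End FreeResolution.
End Homological.

(* Restriction of scalars along the structure map of a k-algebra.             *)
Section Restriction.
Variables (k : fieldType) (A : algType k) (M : lmodType A).

Definition restr : Type := M.
HB.instance Definition _ := GRing.Zmodule.on restr.

Definition restr_scale (c : k) (x : restr) : restr := (c%:A : A) *: (x : M).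

Fact restr_scaleA a b x :
  restr_scale a (restr_scale b x) = restr_scale (a * b) x.
Proof. by rewrite /restr_scale scalerA -scalerAl mul1r scalerA. Qed.
Fact restr_scale1 : left_id 1 restr_scale.
Proof. by move=> x; rewrite /restr_scale scale1r scale1r. Qed.
Fact restr_scaleDr : right_distributive restr_scale +%R.
Proof. by move=> a x y; exact: scalerDr. Qed.
Fact restr_scaleDl x : {morph restr_scale^~ x : a b / a + b}.
Proof. by move=> a b; rewrite /restr_scale !scalerDl. Qed.
HB.instance Definition _ := GRing.Zmodule_isLmodule.Build k restr
  restr_scaleA restr_scale1 restr_scaleDr restr_scaleDl.

Lemma restrZ (c : k) (x : restr) : c *: x = (c%:A : A) *: (x : M).
Proof. by []. Qed.
End Restriction.

(* Bimodules over a k-algebra on which the base field acts centrally.         *)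
Record bimodule (k : fieldType) (A : algType k) := Bimodule {
  bm_sort :> lmodType A;
  bm_ract : bm_sort -> A -> bm_sort;
  bm_ractD : forall a x y, bm_ract (x + y) a = bm_ract x a + bm_ract y a;
  bm_ractDr : forall x a b, bm_ract x (a + b) = bm_ract x a + bm_ract x b;
  bm_ract1 : forall x, bm_ract x 1 = x;
  bm_ractM : forall x a b, bm_ract x (a * b) = bm_ract (bm_ract x a) b;
  bm_assoc : forall a x b, bm_ract (a *: x) b = a *: bm_ract x b;
  bm_central : forall (c : k) x, bm_ract x (c%:A) = c%:A *: x }.

Definition bimod_iso (k : fieldType) (A : algType k) (M N : bimodule A) : Prop :=
  exists f : {linear M -> N}, bijective f /\
    forall x a, f (bm_ract x a) = bm_ract (f x) a.

Section RegularBimodule.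
Variables (k : fieldType) (A : algType k).
Definition regular_bimodule : bimodule A.
Proof.
refine (@Bimodule k A (A^o : lmodType A) (fun x a => (x : A) * a) _ _ _ _ _ _).
- by move=> a x y; rewrite mulrDl.
- by move=> x a b; rewrite mulrDr.
- by move=> x; rewrite mulr1.
- by move=> x a b; rewrite mulrA.
- by move=> a x b; rewrite /GRing.scale /= mulrA.
- by move=> c x; rewrite /GRing.scale /= -scalerAr mulr1 -scalerAl mul1r.
Defined.
End RegularBimodule.

(* The cohomology of Hom_A(P, N), for P a projective resolution and N a       *)
(* bimodule, as a k-vector space with the right A-action inherited from N.    *)
Section Ext.
Variables (k : fieldType) (A : algType k).

Lemma scaler_central (V : lmodType A) (c : k) (a : A) (x : V) :
  c%:A *: (a *: x) = a *: (c%:A *: x).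
Proof. by rewrite !scalerA -scalerAl -scalerAr mul1r mulr1. Qed.

Lemma restr_funE (X : Type) (V : lmodType A) (c : k) (f g : X -> restr V) x :
  (c *: f + g) x = (c%:A : A) *: (f x : V) + (g x : V) :> V.
Proof. by []. Qed.

Variables (M : lmodType A) (P : projective_resolution M).
Variables (N : bimodule A).

Definition is_cocycle (i : nat) (f : P i -> restr N) : Prop :=
  linear (f : P i -> N) /\ forall y, f (pr_d P i y) = 0.

Fact cocycle0 i : is_cocycle (0 : P i -> restr N).
Proof. by split=> // a x y; rewrite scaler0 addr0. Qed.
Fact cocycleP i (c : k) f g :
  @is_cocycle i f -> @is_cocycle i g -> @is_cocycle i (c *: f + g).
Proof.
move=> [fl f0] [gl g0]; split=> [a x y|y].
  by rewrite !restr_funE fl gl !scalerDr scaler_central addrACA.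
by rewrite restr_funE f0 g0 scaler0 addr0.
Qed.
Definition cocycle i : submodule (P i -> restr N) :=
  Submodule (@cocycle0 i) (@cocycleP i).

Definition is_coboundary (i : nat) : (P i -> restr N) -> Prop :=
  match i return (P i -> restr N) -> Prop with
  | 0 => fun f => f = 0
  | j.+1 => fun f =>
      exists2 g : P j -> restr N, linear (g : P j -> N) & f = g \o pr_d P j
  end.

Fact coboundary0 i : is_coboundary (val (0 : subm (cocycle i))).
Proof.
case: i => [//|i]; exists 0; last by rewrite funeqE.
by move=> a x y; rewrite scaler0 addr0.
Qed.
Fact coboundaryP i (c : k) (f g : subm (cocycle i)) :
  is_coboundary (val f) -> is_coboundary (val g) ->
  is_coboundary (val (c *: f + g)).
Proof.
rewrite linearP /=; case: i f g => [|i] f g /=.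
  by move=> -> ->; rewrite scaler0 addr0.
move=> [u ul ->] [v vl ->]; exists (c *: u + v); last by rewrite funeqE.
by move=> a x y; rewrite !restr_funE ul vl !scalerDr scaler_central addrACA.
Qed.
Definition coboundary i : submodule (subm (cocycle i)) :=
  @Submodule _ _ (fun z : subm (cocycle i) => is_coboundary (val z))
    (@coboundary0 i) (@coboundaryP i).

Definition Ext_of (i : nat) : lmodType k := quotm (coboundary i).

Definition fun_ract (X : Type) (f : X -> restr N) (a : A) : X -> restr N :=
  fun x => bm_ract (f x : N) a.

Fact fun_ract_linear (X : lmodType A) (f : X -> restr N) a :
  linear (f : X -> N) -> linear (fun_ract f a : X -> N).
Proof. by move=> fl b x y; rewrite /fun_ract fl bm_ractD bm_assoc. Qed.

Lemma bm_ract0 (a : A) : bm_ract (0 : N) a = 0.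
Proof. by apply: (addrI (bm_ract (0 : N) a)); rewrite -bm_ractD !addr0. Qed.

Fact cocycle_ract i (f : subm (cocycle i)) a : cocycle i (fun_ract (val f) a).
Proof.
have [fl f0] := submP f; split; first exact: fun_ract_linear.
by move=> y; rewrite /fun_ract f0 bm_ract0.
Qed.

Definition Z_ract i (f : subm (cocycle i)) (a : A) : subm (cocycle i) :=
  Subm (cocycle_ract f a).

Fact coboundary_ract i (f : subm (cocycle i)) a :
  coboundary i f -> coboundary i (Z_ract f a).
Proof.
case: i f => [|i] f /= => [->|[g gl ->]].
  by rewrite funeqE => x; rewrite /fun_ract bm_ract0.
by exists (fun_ract g a); [exact: fun_ract_linear | rewrite funeqE].
Qed.

Lemma Z_eqP i (f g : subm (cocycle i)) : (forall x, val f x = val g x) -> f = g.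
Proof. by move=> fg; apply/val_inj/funext. Qed.

Fact Z_ractP i (a : A) (c : k) (f g : subm (cocycle i)) :
  Z_ract (c *: f + g) a = c *: Z_ract f a + Z_ract g a.
Proof.
apply: Z_eqP => x; rewrite [RHS](congr1 (@^~ x) (linearP val c _ _)) restr_funE.
rewrite -[LHS]/(bm_ract (val (c *: f + g) x : N) a).
by rewrite (congr1 (@^~ x) (linearP val c f g)) restr_funE bm_ractD bm_assoc.
Qed.

Definition Ext_ract i (e : Ext_of i) (a : A) : Ext_of i :=
  quot_pi (coboundary i) (Z_ract (quot_repr e) a).

Lemma Ext_ract_pi i (f : subm (cocycle i)) a :
  Ext_ract (quot_pi (coboundary i) f) a = quot_pi (coboundary i) (Z_ract f a).
Proof.
apply/quot_piP; rewrite -scaleN1r addrC -Z_ractP; apply: coboundary_ract.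
rewrite scaleN1r addrC; exact: quot_repr_pi.
Qed.

Fact Ext_ractP i a (c : k) (x y : Ext_of i) :
  Ext_ract (c *: x + y) a = c *: Ext_ract x a + Ext_ract y a.
Proof.
elim/quot_ind: x => x; elim/quot_ind: y => y.
by rewrite -linearP !Ext_ract_pi -linearP Z_ractP.
Qed.
Fact Ext_ractD i a (x y : Ext_of i) :
  Ext_ract (x + y) a = Ext_ract x a + Ext_ract y a.
Proof. by have := Ext_ractP a 1 x y; rewrite !scale1r. Qed.
Fact Ext_ractZ i a (c : k) (x : Ext_of i) :
  Ext_ract (c *: x) a = c *: Ext_ract x a.
Proof.
have z0 : Ext_ract (0 : Ext_of i) a = 0.
  by apply: (addrI (Ext_ract (0 : Ext_of i) a)); rewrite -Ext_ractD !addr0.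
by rewrite -[c *: x]addr0 Ext_ractP z0 addr0.
Qed.
Fact Ext_ractDr i (x : Ext_of i) a b :
  Ext_ract x (a + b) = Ext_ract x a + Ext_ract x b.
Proof.
elim/quot_ind: x => x; rewrite !Ext_ract_pi -linearD; congr (quot_pi (coboundary i)).
by apply: Z_eqP => y; rewrite linearD /= /fun_ract bm_ractDr.
Qed.
Fact Ext_ract1 i (x : Ext_of i) : Ext_ract x 1 = x.
Proof.
elim/quot_ind: x => x; rewrite !Ext_ract_pi; congr (quot_pi (coboundary i)).
by apply: Z_eqP => y; rewrite /= /fun_ract bm_ract1.
Qed.
Fact Ext_ractM i (x : Ext_of i) a b :
  Ext_ract x (a * b) = Ext_ract (Ext_ract x a) b.
Proof.
elim/quot_ind: x => x; rewrite !Ext_ract_pi; congr (quot_pi (coboundary i)).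
by apply: Z_eqP => y; rewrite /= /fun_ract bm_ractM.
Qed.
Fact Ext_ract_central i (c : k) (x : Ext_of i) : Ext_ract x (c%:A) = c *: x.
Proof.
elim/quot_ind: x => x; rewrite Ext_ract_pi -linearZ; congr (quot_pi (coboundary i)).
by apply: Z_eqP => y; rewrite linearZ /= /fun_ract bm_central.
Qed.
End Ext.

(* Any other projective resolution of M gives an isomorphic result.           *)
Definition Ext (k : fieldType) (A : algType k) (i : nat) (M : lmodType A)
  (N : bimodule A) : lmodType k := Ext_of (free_resolution M) N i.

(* An augmentation turns every k-vector space into an A-module.               *)
Section Augmented.
Variables (k : fieldType) (A : algType k) (eps : {lrmorphism A -> k^o}).

Section Trivial.
Variable V : lmodType k.
Definition triv : Type := V.
HB.instance Definition _ := GRing.Zmodule.on triv.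
Definition triv_scale (a : A) (x : triv) : triv := (eps a : k) *: (x : V).

Fact triv_scaleA a b x : triv_scale a (triv_scale b x) = triv_scale (a * b) x.
Proof. by rewrite /triv_scale scalerA rmorphM. Qed.
Fact triv_scale1 : left_id 1 triv_scale.
Proof. by move=> x; rewrite /triv_scale rmorph1 scale1r. Qed.
Fact triv_scaleDr : right_distributive triv_scale +%R.
Proof. by move=> a x y; exact: scalerDr. Qed.
Fact triv_scaleDl x : {morph triv_scale^~ x : a b / a + b}.
Proof. by move=> a b; rewrite /triv_scale rmorphD scalerDl. Qed.
HB.instance Definition _ := GRing.Zmodule_isLmodule.Build A triv
  triv_scaleA triv_scale1 triv_scaleDr triv_scaleDl.

Lemma trivZ (a : A) (x : triv) : a *: x = (eps a : k) *: (x : V) :> V.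
Proof. by []. Qed.
Lemma eps_scalar (c : k) : eps (c%:A) = c :> k.
Proof. by rewrite linearZ rmorph1; exact: mulr1. Qed.
End Trivial.

Definition trivial_module : lmodType A := triv k^o.

Definition trivial_bimodule : bimodule A.
Proof.
refine (@Bimodule k A (triv k^o) (fun x a => (eps a : k) *: (x : k^o)) _ _ _ _ _ _).
- by move=> a x y; exact: scalerDr.
- by move=> x a b; rewrite rmorphD scalerDl.
- by move=> x; rewrite rmorph1 scale1r.
- by move=> x a b; rewrite rmorphM mulrC scalerA.
- by move=> a x b; rewrite !trivZ !scalerA mulrC.
- by move=> c x; rewrite trivZ.
Defined.

(* Ext^d_A(k, A). Its left A-action comes from the right A-action on k: right *)
(* multiplication by a on k is the scalar eps a, hence so is the map that it  *)
(* induces on the k-linear functor Ext^d_A(-, A).                             *)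
Definition left_integral (d : nat) : bimodule A.
Proof.
refine (@Bimodule k A (triv (Ext d trivial_module (regular_bimodule A)))
  (fun x a => Ext_ract x a) _ _ _ _ _ _).
- by move=> a x y; exact: Ext_ractD.
- by move=> x a b; exact: Ext_ractDr.
- by move=> x; exact: Ext_ract1.
- by move=> x a b; exact: Ext_ractM.
- by move=> a x b; exact: Ext_ractZ.
- by move=> c x; rewrite trivZ eps_scalar; exact: Ext_ract_central.
Defined.
End Augmented.

Section Bilinear.
Variables (k : fieldType) (U V W : lmodType k).

Definition bilin (f : U -> V -> W) : Prop :=
  (forall v, linear (f^~ v)) /\ (forall u, linear (f u)).
End Bilinear.

(* The tensor product of two k-vector spaces.                                 *)
Section Tensor.
Variables (k : fieldType) (U V : lmodType k).

Local Notation F := {malg k[(U * V)%type]}.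

Variant tens_gen : F -> Prop :=
| TensGenL a u u' v :
    tens_gen (<< (a *: u + u', v) >> - (a *: << (u, v) >> + << (u', v) >>))
| TensGenR a u v v' :
    tens_gen (<< (u, a *: v + v') >> - (a *: << (u, v) >> + << (u, v') >>)).

Definition in_tens_rel (x : F) : Prop :=
  forall S : submodule F, (forall y, tens_gen y -> S y) -> S x.

Fact tens_rel0 : in_tens_rel 0.
Proof. by move=> S _; exact: smem0. Qed.
Fact tens_relP a u v :
  in_tens_rel u -> in_tens_rel v -> in_tens_rel (a *: u + v).
Proof. by move=> hu hv S hS; apply: smemP; [apply: hu | apply: hv]. Qed.
Definition tens_rel : submodule F := Submodule tens_rel0 tens_relP.

Definition tens : Type := quotm tens_rel.
HB.instance Definition _ := GRing.Lmodule.on tens.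

Definition tensor (u : U) (v : V) : tens := quot_pi tens_rel << (u, v) >>.

(* The map out of the tensor product defined by f; only meaningful when f is  *)
(* bilinear.                                                                  *)
Definition tlift (W : lmodType k) (f : U -> V -> W) (t : tens) : W :=
  flift (fun p => f p.1 p.2) (quot_repr (t : quotm tens_rel)).

Lemma tensor_bilin : bilin tensor.
Proof.
split=> [v a u u'|u a v v']; rewrite /tensor.
  by rewrite -linearP; apply/quot_piP => S; apply; left.
by rewrite -linearP; apply/quot_piP => S; apply; right.
Qed.

Lemma tlift_pi (W : lmodType k) (f : U -> V -> W) x : bilin f ->
  tlift f (quot_pi tens_rel x) = flift (fun p => f p.1 p.2) x.
Proof.
move=> [fl fr]; apply/eqP; rewrite -subr_eq0 -linearB; apply/eqP.
apply: (quot_repr_pi tens_rel x (ker (flift (fun p => f p.1 p.2)))).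
move=> _ [a u u' v|a u v v'] /=; rewrite linearB linearP /= !fliftU !scale1r /=.
  by rewrite fl subrr.
by rewrite fr subrr.
Qed.

Lemma tliftE (W : lmodType k) (f : U -> V -> W) u v : bilin f ->
  tlift f (tensor u v) = f u v.
Proof. by move=> fP; rewrite tlift_pi // fliftU scale1r. Qed.

Lemma tlift_linear (W : lmodType k) (f : U -> V -> W) : bilin f ->
  linear (tlift f).
Proof.
move=> fP a; elim/quot_ind => x; elim/quot_ind => y.
by rewrite -linearP !tlift_pi // linearP.
Qed.

Lemma tlift_funP (W : lmodType k) (f g h : U -> V -> W) a t :
  (forall u v, h u v = a *: f u v + g u v) ->
  tlift h t = a *: tlift f t + tlift g t.
Proof.
move=> hE; rewrite /tlift /flift scaler_sumr -big_split /=.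
apply: eq_bigr => p _.
by rewrite hE scalerDr !scalerA mulrC.
Qed.

Lemma tens_ind (P : tens -> Prop) :
  P 0 -> (forall a x y, P x -> P y -> P (a *: x + y)) ->
  (forall u v, P (tensor u v)) -> forall t, P t.
Proof.
move=> P0 PP Pt; elim/quot_ind => x; rewrite [x]monalgE linear_sum.
elim/big_rec: _ => //= -[u v] y _ Py.
by rewrite malgUZ linearZ; apply: PP => //; exact: Pt.
Qed.
End Tensor.

Section TensorMap2.
Variables (k : fieldType) (U1 U2 V1 V2 W1 W2 : lmodType k).
Variables (f1 : U1 -> V1 -> W1) (f2 : U2 -> V2 -> W2).

(* The bilinear map (u1 (x) u2, v1 (x) v2) |-> f1 u1 v1 (x) f2 u2 v2.         *)
Definition tmap2 (s : tens U1 U2) (t : tens V1 V2) : tens W1 W2 :=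
  tlift (fun u1 u2 => tlift (fun v1 v2 => tensor (f1 u1 v1) (f2 u2 v2)) t) s.

Hypotheses (f1P : bilin f1) (f2P : bilin f2).

Lemma tmap2_in u1 u2 : bilin (fun v1 v2 => tensor (f1 u1 v1) (f2 u2 v2)).
Proof.
split=> [v2 a v1 v1'|v1 a v2 v2'].
  by rewrite f1P.2 (tensor_bilin W1 W2).1.
by rewrite f2P.2 (tensor_bilin W1 W2).2.
Qed.

Lemma tmap2_out t :
  bilin (fun u1 u2 => tlift (fun v1 v2 => tensor (f1 u1 v1) (f2 u2 v2)) t).
Proof.
split=> [u2 a u1 u1'|u1 a u2 u2']; apply: tlift_funP => v1 v2.
  by rewrite (f1P.1 v1) (tensor_bilin W1 W2).1.
by rewrite (f2P.1 v2) (tensor_bilin W1 W2).2.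
Qed.

Lemma tmap2E u1 u2 v1 v2 :
  tmap2 (tensor u1 u2) (tensor v1 v2) = tensor (f1 u1 v1) (f2 u2 v2).
Proof.
by rewrite /tmap2 tliftE ?tliftE //; [exact: tmap2_in | exact: tmap2_out].
Qed.

Lemma tmap2_linearl t : linear (tmap2^~ t).
Proof. exact/tlift_linear/tmap2_out. Qed.

Lemma tmap2_linearr s : linear (tmap2 s).
Proof.
move=> a x y; apply: tlift_funP => u1 u2.
by rewrite (tlift_linear (tmap2_in u1 u2)).
Qed.

End TensorMap2.

Section Trilinear.
Variables (k : fieldType).

Lemma lin_comp (U V W : lmodType k) (f : V -> W) (g : U -> V) :
  linear f -> linear g -> linear (fun x => f (g x)).
Proof. by move=> fl gl a x y; rewrite gl fl. Qed.

Lemma lin_at0 (U V : lmodType k) (f : U -> V) : linear f -> f 0 = 0.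
Proof.
move=> fl; apply: (addrI (f 0)).
by have := fl 1 0 0; rewrite !scale1r !addr0 => <-.
Qed.

Lemma lin_scale (U V : lmodType k) (f : U -> V) a x :
  linear f -> f (a *: x) = a *: f x.
Proof. by move=> fl; have := fl a x 0; rewrite !addr0 lin_at0 // addr0. Qed.

Lemma lin_tens_ext (U V W : lmodType k) (f g : tens U V -> W) :
  linear f -> linear g ->
  (forall u v, f (tensor u v) = g (tensor u v)) -> forall t, f t = g t.
Proof.
move=> fl gl fg; elim/tens_ind => [|a x y IHx IHy|//].
  by rewrite !lin_at0.
by rewrite fl gl IHx IHy.
Qed.

Lemma trilin_ext (U1 U2 V1 V2 W1 W2 X : lmodType k)
    (f g : tens U1 U2 -> tens V1 V2 -> tens W1 W2 -> X) :
  (forall s t, linear (fun r => f r s t)) ->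
  (forall r t, linear (fun s => f r s t)) ->
  (forall r s, linear (f r s)) ->
  (forall s t, linear (fun r => g r s t)) ->
  (forall r t, linear (fun s => g r s t)) ->
  (forall r s, linear (g r s)) ->
  (forall a b c d m n,
     f (tensor a b) (tensor c d) (tensor m n) =
     g (tensor a b) (tensor c d) (tensor m n)) ->
  forall r s t, f r s t = g r s t.
Proof.
move=> f1 f2 f3 g1 g2 g3 fg r s t; move: r; apply: lin_tens_ext => // a b.
move: s; apply: lin_tens_ext => // c d.
by move: t; apply: lin_tens_ext.
Qed.
End Trilinear.

Section AlgebraMul.
Variables (k : fieldType) (A : algType k).
Lemma mul_bilin : bilin (@GRing.mul A).
Proof.
split=> [v a u u'|u a v v']; first by rewrite mulrDl scalerAl.
by rewrite mulrDr scalerAr.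
Qed.
End AlgebraMul.

Record hopfAlgebra (k : fieldType) := HopfAlgebra {
  hopf_alg :> algType k;
  comul : {linear hopf_alg -> tens hopf_alg hopf_alg};
  counit : {lrmorphism hopf_alg -> k^o};
  antipode : {linear hopf_alg -> hopf_alg};
  comulM : forall x y,
    comul (x * y) = tmap2 *%R *%R (comul x) (comul y);
  comul1 : comul 1 = tensor 1 1;
  coassoc : forall x,
    tlift (fun a b => tlift (fun a1 a2 => tensor a1 (tensor a2 b)) (comul a))
      (comul x)
    = tlift (fun a b => tensor a (comul b)) (comul x);
  counitl : forall x, tlift (fun a b => (counit a : k) *: b) (comul x) = x;
  counitr : forall x, tlift (fun a b => (counit b : k) *: a) (comul x) = x;
  antipodel : forall x,
    tlift (fun a b => antipode a * b) (comul x) = (counit x : k)%:A;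
  antipoder : forall x,
    tlift (fun a b => a * antipode b) (comul x) = (counit x : k)%:A }.

(* M (x) N over k, with H acting on either side through the comultiplication. *)
Section TensorBimodule.
Variables (k : fieldType) (H : hopfAlgebra k) (M N : bimodule H).

Definition lactk (X : bimodule H) (a : H) (x : restr X) : restr X :=
  a *: (x : X).
Definition ractk (X : bimodule H) (x : restr X) (a : H) : restr X :=
  bm_ract (x : X) a.

Lemma lactk_bilin X : bilin (@lactk X).
Proof.
split=> [x c a b|a c x y]; rewrite /lactk.
  by rewrite scalerDl restrZ scalerA -scalerAl mul1r.
by rewrite scalerDr !restrZ scaler_central.
Qed.

Lemma ractk_bilin X : bilin (@ractk X).
Proof.
split=> [a c x y|x c a b]; rewrite /ractk.
  by rewrite bm_ractD restrZ bm_assoc.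
by rewrite bm_ractDr -mulr_algl bm_ractM bm_central bm_assoc restrZ.
Qed.

Definition tens_bimod_sort : Type := tens (restr M) (restr N).
HB.instance Definition _ := GRing.Zmodule.on tens_bimod_sort.

Definition tens_lact (a : H) (t : tens_bimod_sort) : tens_bimod_sort :=
  tmap2 (@lactk M) (@lactk N) (comul H a) t.
Definition tens_ract (t : tens_bimod_sort) (a : H) : tens_bimod_sort :=
  tmap2 (@ractk M) (@ractk N) t (comul H a).

Let LM := lactk_bilin M.
Let LN := lactk_bilin N.
Let RM := ractk_bilin M.
Let RN := ractk_bilin N.
Let mulH := mul_bilin H.

Let LP s : linear (tmap2 (@lactk M) (@lactk N) s) := tmap2_linearr LM LN s.
Let Lp t : linear ((tmap2 (@lactk M) (@lactk N))^~ t) := tmap2_linearl LM LN t.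
Let RP t : linear (tmap2 (@ractk M) (@ractk N) t) := tmap2_linearr RM RN t.
Let Rp s : linear ((tmap2 (@ractk M) (@ractk N))^~ s) := tmap2_linearl RM RN s.
Let MP s : linear (tmap2 (@GRing.mul H) (@GRing.mul H) s) :=
  tmap2_linearr mulH mulH s.
Let Mp t : linear ((tmap2 (@GRing.mul H) (@GRing.mul H))^~ t) :=
  tmap2_linearl mulH mulH t.

Fact tens_lactA a b t : tens_lact a (tens_lact b t) = tens_lact (a * b) t.
Proof.
rewrite /tens_lact comulM.
apply: (trilin_ext
  (f := fun r s t => tmap2 (@lactk M) (@lactk N) r (tmap2 _ _ s t))
  (g := fun r s t => tmap2 (@lactk M) (@lactk N) (tmap2 _ _ r s) t)).
- by move=> s x; exact: Lp.
- by move=> r x; exact: lin_comp (LP r) (Lp x).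
- by move=> r s; exact: lin_comp (LP r) (LP s).
- by move=> s x; exact: lin_comp (Lp x) (Mp s).
- by move=> r x; exact: lin_comp (Lp x) (MP r).
- by move=> r s; exact: LP.
by move=> *; rewrite (tmap2E mulH mulH) !(tmap2E LM LN) /lactk !scalerA.
Qed.

Fact tens_lact1 : left_id 1 tens_lact.
Proof.
move=> t; rewrite /tens_lact comul1; move: t.
apply: (lin_tens_ext (g := id)) => [|//|m n]; first exact: LP.
by rewrite (tmap2E LM LN) /lactk !scale1r.
Qed.

Fact tens_lactDr : right_distributive tens_lact +%R.
Proof.
by move=> a x y; have := LP (comul H a) 1 x y; rewrite !scale1r.
Qed.

Fact tens_lactDl t : {morph tens_lact^~ t : a b / a + b}.
Proof.
move=> a b; rewrite /tens_lact linearD.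
by have := Lp t 1 (comul H a) (comul H b); rewrite !scale1r.
Qed.

HB.instance Definition _ := GRing.Zmodule_isLmodule.Build H tens_bimod_sort
  tens_lactA tens_lact1 tens_lactDr tens_lactDl.

Fact tens_ractD a x y : tens_ract (x + y) a = tens_ract x a + tens_ract y a.
Proof.
by have := Rp (comul H a) 1 x y; rewrite !scale1r.
Qed.

Fact tens_ractDr t a b : tens_ract t (a + b) = tens_ract t a + tens_ract t b.
Proof.
rewrite /tens_ract linearD.
by have := RP t 1 (comul H a) (comul H b); rewrite !scale1r.
Qed.

Fact tens_ract1 t : tens_ract t 1 = t.
Proof.
rewrite /tens_ract comul1; move: t.
apply: (lin_tens_ext (g := id)) => [|//|m n]; first exact: Rp.
by rewrite (tmap2E RM RN) /ractk !bm_ract1.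
Qed.

Fact tens_ractM t a b : tens_ract t (a * b) = tens_ract (tens_ract t a) b.
Proof.
rewrite /tens_ract comulM.
apply: (trilin_ext
  (f := fun r s t => tmap2 (@ractk M) (@ractk N) t (tmap2 _ _ r s))
  (g := fun r s t => tmap2 (@ractk M) (@ractk N) (tmap2 _ _ t r) s)).
- by move=> s x; exact: lin_comp (RP x) (Mp s).
- by move=> r x; exact: lin_comp (RP x) (MP r).
- by move=> r s; exact: Rp.
- by move=> s x; exact: lin_comp (Rp s) (RP x).
- by move=> r x; exact: RP.
- by move=> r s; exact: lin_comp (Rp s) (Rp r).
by move=> *; rewrite (tmap2E mulH mulH) !(tmap2E RM RN) /ractk !bm_ractM.
Qed.

Fact tens_assoc a t b : tens_ract (tens_lact a t) b = tens_lact a (tens_ract t b).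
Proof.
rewrite /tens_ract /tens_lact; move: (comul H a) (comul H b) => r s.
apply: (trilin_ext
  (f := fun r s t => tmap2 (@ractk M) (@ractk N) (tmap2 _ _ r t) s)
  (g := fun r s t => tmap2 (@lactk M) (@lactk N) r (tmap2 _ _ t s))) => {a b r s t}.
- by move=> s x; exact: lin_comp (Rp s) (Lp x).
- by move=> r x; exact: RP.
- by move=> r s; exact: lin_comp (Rp s) (LP r).
- by move=> s x; exact: Lp.
- by move=> r x; exact: lin_comp (LP r) (RP x).
- by move=> r s; exact: lin_comp (LP r) (Rp s).
by move=> *; rewrite !(tmap2E LM LN, tmap2E RM RN) /ractk /lactk !bm_assoc.
Qed.

Fact tens_central (c : k) (t : tens_bimod_sort) :
  tens_ract t (c%:A) = (c%:A : H) *: t.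
Proof.
rewrite -[RHS]/(tens_lact c%:A t) /tens_ract /tens_lact linearZ.
rewrite (lin_scale _ _ (RP t)) (lin_scale _ _ (Lp t)).
transitivity (c *: (t : tens (restr M) (restr N))); congr (c *: _).
  exact: tens_ract1.
by rewrite -[LHS]tens_lact1.
Qed.

Definition tens_bimodule : bimodule H :=
  @Bimodule k H tens_bimod_sort tens_ract
    tens_ractD tens_ractDr tens_ract1 tens_ractM tens_assoc tens_central.
End TensorBimodule.

Fixpoint tensor_power (k : fieldType) (H : hopfAlgebra k) (M : bimodule H)
    (n : nat) : bimodule H :=
  match n with
  | 0 => trivial_bimodule (counit H)
  | 1 => M
  | m.+1 => tens_bimodule M (tensor_power M m)
  end.

Section Opposite.
Variables (k : fieldType) (A : algType k).

Definition conv_scale (c : k) (x : A^c) : A^c := c *: (x : A).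
Fact conv_scaleA a b x : conv_scale a (conv_scale b x) = conv_scale (a * b) x.
Proof. exact: scalerA. Qed.
Fact conv_scale1 : left_id 1 conv_scale.
Proof. by move=> x; exact: scale1r. Qed.
Fact conv_scaleDr : right_distributive conv_scale +%R.
Proof. by move=> a x y; exact: scalerDr. Qed.
Fact conv_scaleDl x : {morph conv_scale^~ x : a b / a + b}.
Proof. by move=> a b; exact: scalerDl. Qed.
HB.instance Definition _ := GRing.Zmodule_isLmodule.Build k A^c
  conv_scaleA conv_scale1 conv_scaleDr conv_scaleDl.

Fact conv_scaleAl (a : k) (x y : A^c) : a *: (x * y) = (a *: x) * y.
Proof. exact: (scalerAr a (y : A) x). Qed.
HB.instance Definition _ := GRing.Lmodule_isLalgebra.Build k A^c conv_scaleAl.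
Fact conv_scaleAr (a : k) (x y : A^c) : a *: (x * y) = x * (a *: y).
Proof. exact: (scalerAl a (y : A) x). Qed.
HB.instance Definition _ := GRing.Lalgebra_isAlgebra.Build k A^c conv_scaleAr.

Variable eps : {lrmorphism A -> k^o}.
Definition conv_eps : A^c -> k^o := eps.
Fact conv_eps_linear : linear conv_eps.
Proof. exact: (linearP eps). Qed.
HB.instance Definition _ :=
  GRing.isLinear.Build k A^c k^o _ conv_eps conv_eps_linear.
Fact conv_eps_monoid : monoid_morphism conv_eps.
Proof.
split; first exact: (rmorph1 eps).
by move=> x y; rewrite /conv_eps -[x * y]/((y : A) * (x : A)) rmorphM mulrC.
Qed.
HB.instance Definition _ :=
  GRing.isMonoidMorphism.Build A^c k^o conv_eps conv_eps_monoid.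
End Opposite.

Section ASGorenstein.
Variables (k : fieldType).

Definition one_dimensional (V : lmodType k) : Prop :=
  exists2 e : V, e != 0 & forall x, exists c : k, x = c *: e.

Definition left_AS_Gorenstein (A : algType k) (eps : {lrmorphism A -> k^o})
    (d : nat) : Prop :=
  [/\ inj_dim_is (A^o : lmodType A) d,
      forall i, i != d ->
        forall e : Ext i (trivial_module eps) (regular_bimodule A), e = 0
    & one_dimensional (Ext d (trivial_module eps) (regular_bimodule A))].

(* Right H-modules are left modules over the opposite algebra H^c.            *)
Definition AS_Gorenstein (H : hopfAlgebra k) (d : nat) : Prop :=
  left_AS_Gorenstein (counit H) d /\ left_AS_Gorenstein (conv_eps (counit H)) d.

Lemma AS_Gorenstein_dim_unique (H : hopfAlgebra k) (d e : nat) :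
  AS_Gorenstein H d -> AS_Gorenstein H e -> d = e.
Proof.
move=> [[[led mind] _ _] _] [[[lee mine] _ _] _].
by apply/eqP; rewrite eqn_leq mind ?mine.
Qed.

Definition trivial_power (H : hopfAlgebra k) (d n : nat) : Prop :=
  bimod_iso (tensor_power (left_integral (counit H) d) n)
            (trivial_bimodule (counit H)).

(* The integral order of a Hopf algebra that is AS-Gorenstein of dimension d, *)
(* with None standing for infinity.                                           *)
Definition integral_order (H : hopfAlgebra k) (d : nat) : option nat :=
  match pselect (exists n, (0 < n)%N && `[< trivial_power H d n >]) with
  | left ex => Some (ex_minn ex)
  | right _ => None
  end.
End ASGorenstein.

Section GroupAlgebra.
Variables (k : fieldType) (G : groupType).

Definition grpalg : Type := {malg k[G]}.
HB.instance Definition _ := GRing.Lmodule.on grpalg.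

Definition grp_elt (g : G) : grpalg := << g >>.

Definition ga_mul (x y : grpalg) : grpalg :=
  flift (fun g => flift (fun h => grp_elt (g * h)%g) y) x.

Lemma ga_ext (W : lmodType k) (f1 f2 : grpalg -> W) : linear f1 -> linear f2 ->
  (forall g, f1 (grp_elt g) = f2 (grp_elt g)) -> forall x, f1 x = f2 x.
Proof.
move=> l1 l2 f12.
pose F1 := HB.pack_for {linear {malg k[G]} -> W} f1
  (GRing.isLinear.Build k {malg k[G]} W _ f1 l1).
pose F2 := HB.pack_for {linear {malg k[G]} -> W} f2
  (GRing.isLinear.Build k {malg k[G]} W _ f2 l2).
exact: (free_ext (f := F1) (g := F2)).
Qed.

Lemma ga_fliftE (W : lmodType k) (h : G -> W) g : flift h (grp_elt g) = h g.
Proof. by rewrite /grp_elt fliftU scale1r. Qed.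

Lemma ga_flift_linear (W : lmodType k) (h : G -> W) :
  linear (flift h : grpalg -> W).
Proof. exact: flift_linear. Qed.

Lemma ga_mul_bilin : bilin ga_mul.
Proof.
split=> [y|x a y z]; first exact: ga_flift_linear.
rewrite /ga_mul {1 3 5}/flift scaler_sumr -big_split; apply: eq_bigr => g _ /=.
by rewrite ga_flift_linear scalerDr !scalerA mulrC.
Qed.

Lemma ga_mulE g h : ga_mul (grp_elt g) (grp_elt h) = grp_elt (g * h)%g.
Proof. by rewrite /ga_mul !ga_fliftE. Qed.

Fact ga_mulA : associative ga_mul.
Proof.
have [Lm Rm] := ga_mul_bilin.
move=> x y z; move: x; apply: ga_ext => [||f].
- exact: Lm.
- exact: lin_comp (Lm z) (Lm y).
move: y; apply: ga_ext => [||g].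
- exact: lin_comp (Rm _) (Lm z).
- exact: lin_comp (Lm z) (Rm _).
move: z; apply: ga_ext => [||h].
- exact: lin_comp (Rm _) (Rm _).
- exact: Rm.
by rewrite !ga_mulE mulgA.
Qed.

Fact ga_mul1 : left_id (grp_elt 1%g) ga_mul.
Proof.
apply: ga_ext => [||g]; [exact: ga_mul_bilin.2|by []|by rewrite ga_mulE mul1g].
Qed.

Fact ga_mulr1 : right_id (grp_elt 1%g) ga_mul.
Proof.
apply: ga_ext => [||g]; [exact: ga_mul_bilin.1|by []|by rewrite ga_mulE mulg1].
Qed.

Fact ga_mulDl : left_distributive ga_mul +%R.
Proof. by move=> x y z; have := ga_mul_bilin.1 z 1 x y; rewrite !scale1r. Qed.

Fact ga_mulDr : right_distributive ga_mul +%R.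
Proof. by move=> x y z; have := ga_mul_bilin.2 x 1 y z; rewrite !scale1r. Qed.

Fact ga_oner_neq0 : grp_elt 1%g != 0.
Proof. by rewrite /grp_elt monalgU_eq0 oner_eq0. Qed.

HB.instance Definition _ := GRing.Zmodule_isNzRing.Build grpalg
  ga_mulA ga_mul1 ga_mulr1 ga_mulDl ga_mulDr ga_oner_neq0.

Fact ga_scaleAl (a : k) (x y : grpalg) : a *: (x * y) = (a *: x) * y.
Proof. exact: esym (lin_scale a x (ga_mul_bilin.1 y)). Qed.
HB.instance Definition _ := GRing.Lmodule_isLalgebra.Build k grpalg ga_scaleAl.
Fact ga_scaleAr (a : k) (x y : grpalg) : a *: (x * y) = x * (a *: y).
Proof. exact: esym (lin_scale a y (ga_mul_bilin.2 x)). Qed.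
HB.instance Definition _ := GRing.Lalgebra_isAlgebra.Build k grpalg ga_scaleAr.

Lemma grp_eltM g h : grp_elt g * grp_elt h = grp_elt (g * h)%g.
Proof. exact: ga_mulE. Qed.

Definition ga_comul : grpalg -> tens grpalg grpalg :=
  flift (fun g => tensor (grp_elt g) (grp_elt g)).
HB.instance Definition _ := GRing.isLinear.Build k grpalg
  (tens grpalg grpalg) _ ga_comul (ga_flift_linear _).

Definition ga_counit : grpalg -> k^o := flift (fun=> 1 : k^o).
HB.instance Definition _ := GRing.isLinear.Build k grpalg k^o _ ga_counit
  (ga_flift_linear _).

Definition ga_antipode : grpalg -> grpalg := flift (fun g => grp_elt g^-1%g).
HB.instance Definition _ := GRing.isLinear.Build k grpalg grpalg _ ga_antipode
  (ga_flift_linear _).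

Lemma ga_comulE g : ga_comul (grp_elt g) = tensor (grp_elt g) (grp_elt g).
Proof. exact: ga_fliftE. Qed.
Lemma ga_counitE g : ga_counit (grp_elt g) = 1.
Proof. exact: ga_fliftE. Qed.
Lemma ga_antipodeE g : ga_antipode (grp_elt g) = grp_elt g^-1%g.
Proof. exact: ga_fliftE. Qed.

Let cl : linear ga_comul := ga_flift_linear _.
Let el : linear ga_counit := ga_flift_linear _.
Let al : linear ga_antipode := ga_flift_linear _.
Let Lmul (y : grpalg) : linear (fun x : grpalg => x * y) := ga_mul_bilin.1 y.
Let Rmul (x : grpalg) : linear (fun y : grpalg => x * y) := ga_mul_bilin.2 x.

Fact ga_counit_monoid : monoid_morphism ga_counit.
Proof.
split; first exact: ga_counitE.
move=> x y; move: x; apply: ga_ext => [||g].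
- exact: lin_comp el (Lmul y).
- by move=> a u v; rewrite el mulrDl scalerAl.
move: y; apply: ga_ext => [||h].
- exact: lin_comp el (Rmul _).
- by move=> a u v; rewrite el mulrDr scalerAr.
by rewrite grp_eltM !ga_counitE mulr1.
Qed.
HB.instance Definition _ :=
  GRing.isMonoidMorphism.Build grpalg k^o ga_counit ga_counit_monoid.

Fact ga_comulM x y :
  ga_comul (x * y) = tmap2 *%R *%R (ga_comul x) (ga_comul y).
Proof.
have mP := mul_bilin grpalg.
move: x; apply: ga_ext => [||g].
- exact: lin_comp cl (Lmul y).
- exact: lin_comp (tmap2_linearl mP mP _) cl.
move: y; apply: ga_ext => [||h].
- exact: lin_comp cl (Rmul _).
- exact: lin_comp (tmap2_linearr mP mP _) cl.
by rewrite grp_eltM !ga_comulE (tmap2E mP mP) grp_eltM.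
Qed.

Fact ga_coassoc x :
  tlift (fun a b => tlift (fun a1 a2 => tensor a1 (tensor a2 b)) (ga_comul a))
    (ga_comul x)
  = tlift (fun a b => tensor a (ga_comul b)) (ga_comul x).
Proof.
have [Tl Tr] := tensor_bilin grpalg grpalg.
have [Sl Sr] := tensor_bilin grpalg (tens grpalg grpalg).
have B1 (b : grpalg) : bilin (fun a1 a2 : grpalg => tensor a1 (tensor a2 b)).
  by split=> [a2|a1]; [exact: (Sl (tensor a2 b)) | exact: lin_comp (Sr a1) (Tl b)].
have B2 : bilin (fun a b : grpalg =>
    tlift (fun a1 a2 => tensor a1 (tensor a2 b)) (ga_comul a)).
  split=> [b|a c u v]; first exact: lin_comp (tlift_linear (B1 b)) cl.
  by apply: tlift_funP => a1 a2; rewrite Tr Sr.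
have B3 : bilin (fun a b : grpalg => tensor a (ga_comul b)).
  by split=> [b|a]; [exact: (Sl (ga_comul b)) | exact: lin_comp (Sr a) cl].
move: x; apply: ga_ext => [||g].
- exact: lin_comp (tlift_linear B2) cl.
- exact: lin_comp (tlift_linear B3) cl.
rewrite ga_comulE [RHS](tliftE _ _ B3) [LHS](tliftE _ _ B2) ga_comulE.
exact: tliftE (B1 _).
Qed.

Fact ga_counitl x :
  tlift (fun a b : grpalg => (ga_counit a : k) *: b) (ga_comul x) = x.
Proof.
have B : bilin (fun a b : grpalg => (ga_counit a : k) *: b).
  split=> [b c u v|a c u v]; first by rewrite el scalerDl -scalerA.
  by rewrite scalerDr !scalerA mulrC.
move: x; apply: (ga_ext (f2 := id)) => [|//|g].
  exact: lin_comp (tlift_linear B) cl.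
by rewrite ga_comulE (tliftE _ _ B) ga_counitE scale1r.
Qed.

Fact ga_counitr x :
  tlift (fun a b : grpalg => (ga_counit b : k) *: a) (ga_comul x) = x.
Proof.
have B : bilin (fun a b : grpalg => (ga_counit b : k) *: a).
  split=> [b c u v|a c u v]; last by rewrite el scalerDl -scalerA.
  by rewrite scalerDr !scalerA mulrC.
move: x; apply: (ga_ext (f2 := id)) => [|//|g].
  exact: lin_comp (tlift_linear B) cl.
by rewrite ga_comulE (tliftE _ _ B) ga_counitE scale1r.
Qed.

Lemma ga_unit_linear : linear (fun x => (ga_counit x : k)%:A : grpalg).
Proof. by move=> a u v; rewrite el scalerDl -scalerA. Qed.

Fact ga_antipodel x :
  tlift (fun a b : grpalg => ga_antipode a * b) (ga_comul x)
  = (ga_counit x : k)%:A.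
Proof.
have B : bilin (fun a b : grpalg => ga_antipode a * b).
  by split=> [b|a]; [exact: lin_comp (Lmul b) al | exact: Rmul].
move: x; apply: ga_ext => [||g].
- exact: lin_comp (tlift_linear B) cl.
- exact: ga_unit_linear.
by rewrite ga_comulE (tliftE _ _ B) ga_antipodeE ga_counitE grp_eltM mulVg scale1r.
Qed.

Fact ga_antipoder x :
  tlift (fun a b : grpalg => a * ga_antipode b) (ga_comul x)
  = (ga_counit x : k)%:A.
Proof.
have B : bilin (fun a b : grpalg => a * ga_antipode b).
  by split=> [b|a]; [exact: Lmul | exact: lin_comp (Rmul a) al].
move: x; apply: ga_ext => [||g].
- exact: lin_comp (tlift_linear B) cl.
- exact: ga_unit_linear.
by rewrite ga_comulE (tliftE _ _ B) ga_antipodeE ga_counitE grp_eltM mulgV scale1r.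
Qed.

Definition group_algebra : hopfAlgebra k :=
  @HopfAlgebra k grpalg ga_comul ga_counit ga_antipode
    ga_comulM (ga_comulE 1%g) ga_coassoc ga_counitl ga_counitr
    ga_antipodel ga_antipoder.
End GroupAlgebra.

Section GroupConditions.
Variable G : groupType.
Local Open Scope group_scope.

Definition finitely_generated : Prop :=
  exists s : seq G, forall S : {pred G},
    group_closed S -> {subset s <= S} -> forall g, g \in S.

Definition central (z : G) : Prop := forall g, commute z g.

(* Finitely many left cosets of the center cover the group.                   *)
Definition central_by_finite : Prop :=
  exists s : seq G, forall g, exists2 r, r \in s & central (r^-1 * g).
End GroupConditions.

(* Main.v *)
Require Import Defs.
From HB Require Import structures.
From mathcomp Require Import all_boot all_order all_algebra.
From mathcomp Require Import finmap.
From mathcomp.classical Require Import boolp classical_sets functions.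
From mathcomp.multinomials Require Import monalg.
From mathcomp Require Import zify.

Set Implicit Arguments.
Unset Strict Implicit.
Unset Printing Implicit Defensive.

Import Order.TTheory GRing.Theory Num.Theory.
Local Open Scope ring_scope.

(** Let A be a central subgroup of G that has finite index and is free abelian
    on z_0, ..., z_(d-1); it exists because G is finitely generated and central
    by finite ([central_lattice]).  Write kA = k[Z^d], and let pi : kG -> kA be
    the k-linear map that forgets the group elements outside A.  As A is
    central, pi is kA-linear and pi (x y) = pi (y x).  Sending n to the
    functional y |-> pi (y n) identifies kG with the k-linear maps
    f : kG -> kA such that f (z_j y) = z_j f (y) for all j < d
    ([theta_inj], [theta_onto]); finiteness of the index is what makes every
    such f come from an element of kG.

    All k-linear maps kG -> kA form a coinduced, hence injective, left module E
    ([coind_injective]).  Let W_j be the submodule of those f that satisfy the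
    first j of the d equations, so that W_0 = E and W_d = kG.  The defect
    f |-> f (z_j -) - z_j f of the next equation maps W_j onto itself
    ([defect_onto]), which gives exact sequences of left modules
      0 -> W_(j+1) -> W_j -> W_j -> 0.
    Each of them raises the injective dimension by at most one, so that the one
    of kG is at most d ([coresolvable_kernel]).

    The same sequences compute Ext (k, kG) ([cohomology]).  The module
    Hom (k, W_0) consists of the functionals y |-> eps y v with v in kA, and
    there the j-th defect is multiplication by 1 - z_j.  These elements form a
    regular sequence on kA, so by induction Ext^i (k, W_j) vanishes for i <> j
    and is kA / (1 - z_0, ..., 1 - z_(j-1)) for i = j; for j = d this quotient
    is k.  As Ext^d (k, kG) is not zero, the injective dimension of kG is
    exactly d.

    Finally, right multiplication by x on kG turns into f |-> f (x -), because
    pi (y n x) = pi (x y n); on the functionals y |-> eps y v this is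
    multiplication by eps x.  Hence kG acts through eps on the right of
    Ext^d (k, kG) ([ext_ract_eps]).  It acts through eps on the left as well, so
    the integral is the trivial bimodule and its order is one
    ([integral_order1]).

    The opposite algebra of kG has the basis g |-> g^-1, which multiplies as G
    does.  The argument is therefore carried out for an algebra with a basis
    that multiplies as G, and is applied to kG and to its opposite
    ([group_like_Gorenstein]). *)

(** * Linear maps and injective dimension *)

Section LinearMaps.
Variable R : pzRingType.
Implicit Types A B C X : lmodType R.

(** Linear maps as bundled objects, from the proposition [linear] that the
    cochains are stated with. *)
Definition lin_of A B (f : A -> B) (fl : linear f) : {linear A -> B} :=
  HB.pack_for {linear A -> B} f (GRing.isLinear.Build R A B _ f fl).

Arguments lin_of A B f fl /.

Definition surjective_map A B (f : A -> B) : Prop := forall b, exists a, f a = b.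

Lemma lin_inj A B (f : {linear A -> B}) :
  (forall x, f x = 0 -> x = 0) -> injective f.
Proof.
move=> f0 x y /eqP; rewrite -subr_eq0 -linearB => /eqP /f0 /eqP.
by rewrite subr_eq0 => /eqP.
Qed.

Lemma factor_surj A B C (p : {linear A -> B}) (f : {linear A -> C}) :
  surjective_map p -> (forall x, p x = 0 -> f x = 0) ->
  exists h : {linear B -> C}, forall x, h (p x) = f x.
Proof.
move=> /choice[s sP] pf.
have pfE x y : p x = p y -> f x = f y.
  move=> pxy; apply/eqP; rewrite -subr_eq0 -linearB; apply/eqP/pf.
  by rewrite linearB pxy subrr.
have hl : linear (fun b => f (s b)).
  by move=> a x y; rewrite -linearP; apply: pfE; rewrite linearP !sP.
by exists (lin_of hl) => x; apply: pfE; rewrite sP.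
Qed.

Lemma factor_inj A B X (i : {linear A -> B}) (f : {linear X -> B}) :
  injective i -> (forall x, exists a, i a = f x) ->
  exists h : {linear X -> A}, forall x, i (h x) = f x.
Proof.
move=> inji /choice[h hP].
have hl : linear h by move=> a x y; apply: inji; rewrite linearP !hP linearP.
by exists (lin_of hl).
Qed.

Definition exact3 A B C (i : A -> B) (p : B -> C) : Prop :=
  [/\ injective i, surjective_map p & forall x, p x = 0 <-> exists y, i y = x].

End LinearMaps.

Section InjectiveDimension.
Variable R : nzRingType.
Implicit Types A B C I N : lmodType R.

(** The injective module extends maps along any [u], injective or not, as long as
    they factor through the image of [u]: pass to the quotient by the kernel. *)
Lemma inj_extend A B I (u : {linear A -> B}) (f : {linear A -> I}) :
  injective_module I -> (forall x, u x = 0 -> f x = 0) ->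
  exists h : {linear B -> I}, forall x, h (u x) = f x.
Proof.
move=> injI uf; pose S := ker u.
have piS : surjective_map (@quot_pi R A S).
  by move=> b; exists (quot_repr b); exact: quot_reprK.
have pi0 x : quot_pi S x = 0 -> u x = 0.
  rewrite -(linear0 (@quot_pi R A S)) => /quot_piP.
  by rewrite subr0.
have [u' u'P] := factor_surj piS pi0.
have [f' f'P] := factor_surj piS (fun x px => uf x (pi0 x px)).
have inju' : injective u'.
  apply: lin_inj; elim/quot_ind => x; rewrite u'P => ux.
  by rewrite -(linear0 (@quot_pi R A S)); apply/quot_piP; rewrite subr0.
have [h hP] := injI _ _ u' f' inju'.
by exists h => x; rewrite -u'P hP f'P.
Qed.

Lemma injective_iso N I (f : {linear N -> I}) :
  injective f -> surjective_map f -> injective_module I -> injective_module N.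
Proof.
move=> injf surf injI A B u g inju.
have [h hP] := injI A B u (f \o g) inju.
have [h' h'P] := factor_inj injf (fun x => surf (h x)).
by exists h' => x; apply: injf; rewrite h'P hP.
Qed.

Lemma injective_prod I N :
  injective_module I -> injective_module N -> injective_module (I * N)%type.
Proof.
move=> injI injN A B u g inju.
have g1l : linear (fun x => (g x).1) by move=> a x y; rewrite linearP.
have g2l : linear (fun x => (g x).2) by move=> a x y; rewrite linearP.
have [h1 h1P] := injI A B u (lin_of g1l) inju.
have [h2 h2P] := injN A B u (lin_of g2l) inju.
have hl : linear (fun x => (h1 x, h2 x)).
  by move=> a x y; rewrite !linearP.
by exists (lin_of hl) => x /=; rewrite h1P h2P /=; case: (g x).
Qed.

(** Injective dimension at most [n], one cosyzygy at a time.  Unlike a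
    resolution, this form is suited to induction on [n] along exact sequences. *)
Fixpoint coresolvable n N : Prop :=
  if n is m.+1 then
    exists I C (i : {linear N -> I}) (p : {linear I -> C}),
      [/\ injective_module I, exact3 i p & coresolvable m C]
  else injective_module N.

Lemma coresolvable_iso n N N' (f : {linear N -> N'}) :
  injective f -> surjective_map f -> coresolvable n N' -> coresolvable n N.
Proof.
move=> injf surf; case: n => [|n] /=; first exact: (injective_iso injf surf).
move=> [I [C [i [p [injI [inji surp ex] idC]]]]].
exists I, C, (i \o f), p; split=> //; split=> //.
  by move=> x y /= /inji /injf.
move=> x; rewrite ex; split=> [[y <-]|[y <-]]; last by exists (f y).
by have [z <-] := surf y; exists z.
Qed.

Lemma coresolvable_prod n I C :
  injective_module I -> coresolvable n C -> coresolvable n (I * C)%type.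
Proof.
move=> injI; case: n => [|n] /=; first exact: injective_prod.
move=> [I2 [C2 [i [p [injI2 [inji surp ex] idC]]]]].
have il : linear (fun x : (I * C)%type => (x.1, i x.2)).
  by move=> a x y; rewrite /= linearP.
have pl : linear (fun x : (I * I2)%type => p x.2).
  by move=> a x y; rewrite /= linearP.
exists (I * I2)%type, C2, (lin_of il), (lin_of pl); split=> //.
  exact: injective_prod.
split=> /=.
- by move=> [x1 x2] [y1 y2] /= [-> /inji ->].
- by move=> b; have [a <-] := surp b; exists (0, a).
move=> [x1 x2] /=; rewrite ex; split=> [[y <-]|[[y1 y2] /= [_ <-]]].
  by exists (x1, y).
by exists y2.
Qed.

(** The mapping cone argument, without lifting to whole resolutions: embed [N]
    and [N''] in injectives [I] and [I''] with cokernels [C] and [C''], and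
    extend [D] to [I -> I''] and [C -> C''].  The cokernel of [N' -> I] is then
    the kernel of a surjection from [I'' * C] onto [C''], to which the induction
    hypothesis applies. *)
Lemma coresolvable_kernel n N' N N'' (i : {linear N' -> N}) (D : {linear N -> N''}) :
  exact3 i D -> coresolvable n N -> coresolvable n N'' -> coresolvable n.+1 N'.
Proof.
elim: n N' N N'' i D => [|n IHn] N' N N'' i D exD.
  by move=> injN injN''; exists N, N'', i, D.
case: (exD) => inji surD kerD.
move=> [I [C [j [p [injI [injj surp exp] idC]]]]].
move=> [I'' [C'' [j'' [p'' [injI'' [injj'' surp'' exp''] idC'']]]]].
have [D1 D1P] := injI'' _ _ j (j'' \o D) injj.
have [D2 D2P] : exists D2 : {linear C -> C''}, forall x, D2 (p x) = (p'' \o D1) x.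
  apply: factor_surj => // x /exp[y <-] /=.
  by rewrite D1P; apply/exp''; exists (D y).
(* [X] is the cokernel of [N' -> I], embedded by [x |-> (D1 x, p x)]. *)
have sl : linear (fun x : (I'' * C)%type => p'' x.1 - D2 x.2).
  move=> a x y; rewrite /= (linearP p'' a x.1 y.1) (linearP D2 a x.2 y.2).
  by rewrite opprD addrACA -scalerBr.
pose sg := lin_of sl; pose X := ker sg.
have kl : linear (fun x : I => (D1 x, p x)) by move=> a x y; rewrite !linearP.
pose ka := lin_of kl.
have [ka' ka'P] : exists ka' : {linear I -> subm X}, forall x, val (ka' x) = ka x.
  apply: (factor_inj (i := (val : {linear subm X -> _}))); first exact: val_inj.
  move=> x; suff Xx : X (ka x) by exists (Subm Xx).
  by rewrite /= D2P subrr.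
exists I, (subm X), (j \o i), ka'; split=> //.
  split.
  - by move=> x y /= /injj /inji.
  - move=> x; have /= := submP x; case xE: (val x) => [a c] /= /eqP.
    have [b bE] := surp c.
    rewrite subr_eq0 -bE D2P /= => /eqP ab.
    have /exp''[n''] : p'' (a - D1 b) = 0 by rewrite linearB ab subrr.
    have [m <-] := surD n''; rewrite -[j'' _]/((j'' \o D) m) -D1P => mE.
    exists (b + j m); apply: val_inj; rewrite ka'P xE /= !linearD mE addrC subrK.
    by rewrite bE (_ : p (j m) = 0) ?addr0 //; apply/exp; exists m.
  move=> x; split=> [kx0|[y <-]].
    have : ka x = 0 by rewrite -ka'P kx0.
    move=> [D1x /exp[m mE]]; move: D1x; rewrite -mE D1P /=.
    rewrite -(linear0 j'') => /injj'' /kerD[m' <-].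
    by exists m'.
  apply: val_inj; rewrite ka'P /= D1P /=.
  rewrite (_ : D (i y) = 0); last by apply/kerD; exists y.
  by rewrite linear0 (_ : p _ = 0) //; apply/exp; exists (i y).
apply: (IHn _ _ _ (val : {linear subm X -> _}) sg); last by [].
  split; first exact: val_inj.
    by move=> c; have [a <-] := surp'' c; exists (a, 0); rewrite /= linear0 subr0.
  move=> x; split=> [sx|[y <-]]; last exact: (submP (y : subm X)).
  by exists (Subm (sx : X x)).
exact: coresolvable_prod.
Qed.

Lemma coresolvable_inj_dim_le n N : coresolvable n N -> inj_dim_le N n.
Proof.
elim: n N => [|n IHn] N.
  move=> injN; pose Z : lmodType R := 'M[R]_(0, 0).
  have Z0 (x y : Z) : x = y by apply/matrixP => -[].
  pose J m : lmodType R := if m is 0%N then N else Z.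
  pose Jd m : {linear J m -> J m.+1} :=
    lin_of (f := (fun=> 0) : J m -> J m.+1) (fun a x y => Z0 _ _).
  have injJ m : injective_module (J m).
    case: m => // m A B f g _.
    by exists (lin_of (f := (fun=> 0) : B -> Z) (fun a x y => Z0 _ _)) => x; exact: Z0.
  unshelve eexists (@InjectiveResolution R N J Jd (idfun : {linear N -> J 0%N}) injJ _ _ _).
  - by move=> x y.
  - by move=> x; split=> [_|_]; [exists x | exact: Z0].
  - by move=> m x; split=> [_|_]; [exists 0; exact: Z0 | exact: Z0].
  by case=> // m _ x; exact: Z0.
move=> [I [C [i [p [injI [inji surp exp] /IHn[J Jn]]]]]].
pose J' m : lmodType R := if m is m'.+1 then J m' else I.
pose Jd m : {linear J' m -> J' m.+1} :=
  match m return {linear J' m -> J' m.+1} with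
  | 0 => ir_aug J \o p | m'.+1 => ir_d J m' end.
have injJ m : injective_module (J' m) by case: m => //= m; exact: ir_injective.
unshelve eexists (@InjectiveResolution R N J' Jd i injJ inji _ _).
- move=> x; rewrite -exp /=; split=> [|->]; last by rewrite linear0.
  by rewrite -(linear0 (ir_aug J)) => /(ir_inj).
- case=> [|m] x /=; last exact: ir_exact.
  rewrite ir_exact0; split=> [[c <-]|[y <-]]; last by exists (p y).
  by have [y <-] := surp c; exists y.
by case=> //= m mn; exact: Jn.
Qed.

Lemma inj_dim_le_coresolvable n N : inj_dim_le N n -> coresolvable n N.
Proof.
elim: n N => [|n IHn] N [J Jn].
  apply: (injective_iso (f := ir_aug J)); [exact: ir_inj| |exact: ir_injective].
  by move=> x; apply/ir_exact0; exact: Jn.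
pose S := ker (ir_d J 1).
have [p pP] : exists p : {linear J 0 -> subm S}, forall x, val (p x) = ir_d J 0 x.
  apply: (factor_inj (i := (val : {linear subm S -> _}))); first exact: val_inj.
  move=> x; suff Sx : S (ir_d J 0 x) by exists (Subm Sx).
  by apply/ir_exact; exists x.
exists (J 0), (subm S), (ir_aug J), p; split.
- exact: ir_injective.
- split; first exact: ir_inj.
    by move=> x; have /ir_exact[y yE] := submP x; exists y; apply: val_inj; rewrite pP.
  move=> x; rewrite -ir_exact0 -pP; split=> [->//|px].
  exact: val_inj.
apply: IHn.
unshelve eexists (@InjectiveResolution R (subm S) (fun m => J m.+1)
  (fun m => ir_d J m.+1) (val : {linear subm S -> _}) _ _ _ _).
- by move=> m; exact: ir_injective.
- exact: val_inj.
- move=> x; split=> [sx|[y <-]]; last exact: (submP (y : subm S)).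
  by exists (Subm (sx : S x)).
- by move=> m x; exact: ir_exact.
by move=> m mn x; exact: Jn.
Qed.

(** Dimension shifting in the second variable.  The hypothesis [n <= i] matches a
    cocycle in degree [i.+1], that is, in a degree larger than [n]. *)
Lemma coresolvable_ext_vanish n N M (P : projective_resolution M) i
    (f : {linear P i.+1 -> N}) :
  coresolvable n N -> (n <= i)%N -> (forall x, f (pr_d P i.+1 x) = 0) ->
  exists h : {linear P i -> N}, forall x, f x = h (pr_d P i x).
Proof.
elim: n N i f => [|n IHn] N i f.
  move=> injN _ f0.
  have [|h hP] := inj_extend (u := pr_d P i) (f := f) injN; last by exists h.
  by move=> x /pr_exact[y <-].
move=> [I [C [j [p [injI [injj surp exp] idC]]]]]; case: i f => // i f le_n f0.
have [h hP] : exists h : {linear P i.+1 -> I}, forall x, h (pr_d P i.+1 x) = (j \o f) x.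
  by apply: inj_extend => // x /pr_exact[y <-] /=; rewrite f0 linear0.
have [|k kP] := IHn C i (p \o h) idC le_n.
  by move=> x /=; rewrite hP /=; apply/exp; exists (f x).
have [k' k'P] := @pr_projective R M P i I C p k surp.
have [l lP] : exists l : {linear P i.+1 -> N}, forall x, j (l x) = (h \- (k' \o pr_d P i)) x.
  apply: factor_inj => // x; apply/exp.
  by rewrite /= linearB k'P -kP subrr.
exists l => x; apply: injj; rewrite lP /= hP /=.
have dd0 : pr_d P i (pr_d P i.+1 x) = 0 by apply/pr_exact; exists x.
by rewrite dd0 linear0 subr0.
Qed.

End InjectiveDimension.

(** * Coinduced modules are injective *)

Section VectorSpaces.
Variable k : fieldType.

(** A complement of the image, by Zorn's lemma among the subspaces that meet the
    image trivially. *)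
Lemma complement_exists (X B : lmodType k) (u : {linear X -> B}) :
  exists S : B -> Prop,
    [/\ forall a x y, S x -> S y -> S (a *: x + y),
        forall x, S (u x) -> u x = 0
      & forall b, exists x, S (b - u x)].
Proof.
pose P : set (set B) := fun S =>
  (forall a x y, S x -> S y -> S (a *: x + y)) /\ (forall x, S (u x) -> u x = 0).
(* The empty set satisfies [P], so that empty chains are harmless; a maximal
   [S] contains 0 all the same, as shown next. *)
have [|S [[Slin Su] Smax]] := @Zorn_bigcup B P.
  move=> F FP Ftot; split=> [a x y [X1 F1 X1x] [X2 F2 X2y]|x [X1 F1 X1x]]; last first.
    exact: (FP _ F1).2.
  have [le12|le21] := Ftot _ _ F1 F2.
    by exists X2 => //; apply: (FP _ F2).1 => //; exact: le12.
  by exists X1 => //; apply: (FP _ F1).1 => //; exact: le21.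
have S0 : S 0.
  apply: contrapT => nS0; apply: (Smax [set 0]%classic).
    split=> [y Sy|le0S]; last by apply: nS0; exact: le0S.
    by case: nS0; have := Slin (-1) _ _ Sy Sy; rewrite scaleN1r addNr.
  by split=> [a y z -> ->|y ->] //; rewrite scaler0 addr0.
exists S; split=> // b; apply: contrapT => bS.
(* If [b] is not in [S] plus the image, then [T = S + k b] contradicts
   maximality. *)
pose T : set B := fun y => exists c, S (y - c *: b).
apply: (Smax T).
  split=> [y Sy|TS]; first by exists 0; rewrite scale0r subr0.
  apply: bS; exists 0; rewrite linear0 subr0; apply: TS; exists 1.
  by rewrite scale1r subrr.
split=> [a x y [c cx] [e ey]|x [c cx]].
  exists (a * c + e).
  have -> : a *: x + y - (a * c + e) *: b = a *: (x - c *: b) + (y - e *: b).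
    by rewrite scalerBr scalerDl scalerA opprD addrACA.
  exact: Slin.
have [c0|c0] := eqVneq c 0; first by move: cx; rewrite c0 scale0r subr0 => /Su.
case: bS; exists (c^-1 *: x); have := Slin (- c^-1) _ _ cx S0.
rewrite addr0 scaleNr -scalerN opprB scalerBr scalerA mulVf // scale1r.
by rewrite -(linearZ_LR u).
Qed.

Lemma vector_space_injective (V : lmodType k) : injective_module V.
Proof.
move=> X B u g inju.
have [S [Slin Su /choice[s sP]]] := complement_exists u.
have sE b x : S (b - u x) -> s b = x.
  move=> Sbx; apply: inju; apply/eqP; rewrite -subr_eq0 -linearB; apply/eqP/Su.
  have := Slin (-1) _ _ (sP b) Sbx.
  by rewrite scaleN1r opprB addrA subrK linearB.
have sl : linear s.
  move=> a x y; apply: sE.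
  have -> : a *: x + y - u (a *: s x + s y) = a *: (x - u (s x)) + (y - u (s y)).
    by rewrite linearP scalerBr opprD addrACA.
  exact: Slin.
exists (g \o lin_of sl) => x /=; congr (g _); apply: sE.
rewrite subrr; have := Slin (-1) _ _ (sP 0) (sP 0).
by rewrite scaleN1r addNr.
Qed.

End VectorSpaces.

Section Coinduced.
Variables (k : fieldType) (A : algType k) (V : lmodType k).

Fact lin_sub0 : linear (0 : A -> V).
Proof. by move=> a x y; rewrite scaler0 addr0. Qed.
Fact lin_subP (c : k) (f g : A -> V) :
  linear f -> linear g -> linear (c *: f + g).
Proof.
move=> fl gl a x y.
rewrite -[LHS]/(c *: f (a *: x + y) + g (a *: x + y)).
rewrite -[RHS]/(a *: (c *: f x + g x) + (c *: f y + g y)) fl gl !scalerDr !scalerA.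
by rewrite addrACA mulrC.
Qed.
Definition lin_sub : submodule (A -> V) := Submodule lin_sub0 lin_subP.

Definition coind : Type := subm lin_sub.
HB.instance Definition _ := GRing.Zmodule.on coind.

Definition ap (f : coind) : A -> V := val f.

Lemma ap_linear (f : coind) : linear (ap f).
Proof. exact: (submP f). Qed.

Lemma apD f g y : ap (f + g) y = ap f y + ap g y.
Proof. by []. Qed.
Lemma ap0 y : ap 0 y = 0.
Proof. by []. Qed.

Lemma coindP (f g : coind) : (forall y, ap f y = ap g y) -> f = g.
Proof. by move=> fg; apply/val_inj/funext. Qed.

Definition mkcoind (f : A -> V) (fl : linear f) : coind := Subm (fl : lin_sub f).

Lemma apE f (fl : linear f) y : ap (mkcoind fl) y = f y.
Proof. by []. Qed.

(** [A] acts by right multiplication on the argument: this is the module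
    coinduced from the base field, Hom_k (A, V). *)
Fact coind_scale_lin (x : A) (f : coind) : linear (fun y => ap f (y * x)).
Proof. by move=> a y z; rewrite mulrDl -scalerAl ap_linear. Qed.
Definition coind_scale (x : A) (f : coind) : coind := mkcoind (coind_scale_lin x f).

Fact coind_scaleA a b f : coind_scale a (coind_scale b f) = coind_scale (a * b) f.
Proof. by apply: coindP => y; rewrite !apE mulrA. Qed.
Fact coind_scale1 : left_id 1 coind_scale.
Proof. by move=> f; apply: coindP => y; rewrite apE mulr1. Qed.
Fact coind_scaleDr : right_distributive coind_scale +%R.
Proof. by move=> a f g; apply: coindP => y; rewrite apE !apD. Qed.
Fact coind_scaleDl f : {morph coind_scale^~ f : a b / a + b}.
Proof.
move=> a b; apply: coindP => y; rewrite apD !apE mulrDr.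
by have := ap_linear f 1 (y * a) (y * b); rewrite !scale1r.
Qed.
HB.instance Definition _ := GRing.Zmodule_isLmodule.Build A coind
  coind_scaleA coind_scale1 coind_scaleDr coind_scaleDl.

Lemma apZ (x : A) (f : coind) y : ap (x *: f) y = ap f (y * x).
Proof. by []. Qed.

Lemma apZk (c : k) (f : coind) y : ap (c%:A *: f) y = c *: ap f y.
Proof. by rewrite apZ -scalerAr mulr1 (lin_scale _ _ (@ap_linear f)). Qed.

(** By adjunction, [A]-linear maps into Hom_k (A, V) are k-linear maps into [V]:
    compose with evaluation at 1. *)
Lemma coind_injective : injective_module (coind : lmodType A).
Proof.
move=> X B u g inju.
have ul : linear (u : restr X -> restr B) by move=> a x y; rewrite !restrZ linearP.
have gl : linear (fun x : restr X => ap (g x) 1).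
  by move=> a x y; rewrite restrZ linearP apD apZk.
have [h0 h0P] := @vector_space_injective k V _ _ (lin_of ul) (lin_of gl) inju.
have hl b : linear (fun y : A => h0 (y *: (b : B) : restr B)).
  by move=> a x y; rewrite scalerDl -[a *: x]mulr_algl -scalerA -restrZ linearP.
have Hl : linear (fun b : B => mkcoind (hl b)).
  move=> a x y; apply: coindP => z; rewrite apD apZ !apE scalerDr scalerA.
  exact: linearD.
exists (lin_of Hl) => x; apply: coindP => y; rewrite apE -linearZ.
by rewrite -[LHS]/(h0 (lin_of ul (y *: x))) h0P /= linearZ apZ mul1r.
Qed.

End Coinduced.

(** * Imposing equivariance one generator at a time *)

(** [z j] stands for the j-th generator of the central lattice and [zeta j] for
    its action on the values. *)
Section EquivariantFunctions.
Variables (k : fieldType) (A : algType k) (V : lmodType k).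
Variables (z : nat -> A) (zeta : nat -> {linear V -> V}).
Hypothesis zC : forall j x, z j * x = x * z j.
Hypothesis zetaC : forall i j v, zeta i (zeta j v) = zeta j (zeta i v).

Local Notation E := (coind A V).

Fact defect_lin j (f : E) : linear (fun y => ap f (z j * y) - zeta j (ap f y)).
Proof.
move=> a x y; rewrite mulrDr -scalerAr !ap_linear linearP.
by rewrite opprD addrACA scalerBr.
Qed.

(** The failure of [f] to satisfy the j-th equivariance equation. *)
Definition defect j (f : E) : E := mkcoind (defect_lin j f).

Lemma defectE j f y : ap (defect j f) y = ap f (z j * y) - zeta j (ap f y).
Proof. by []. Qed.

Fact defect_linear j : linear (defect j).
Proof.
move=> a f g; apply: coindP => y.
rewrite !(defectE, apD, apZ) mulrA linearD opprD addrACA.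
by congr (_ + _).
Qed.
HB.instance Definition _ j := GRing.isLinear.Build A E E _ (defect j) (defect_linear j).

Lemma defectC i j f : defect i (defect j f) = defect j (defect i f).
Proof.
apply: coindP => y; rewrite !defectE !linearB /= !mulrA [z i * z j]zC zetaC.
by rewrite -!addrA; congr (_ + _); rewrite addrCA.
Qed.

Fact premul_lin x (f : E) : linear (fun y => ap f (x * y)).
Proof. by move=> a u v; rewrite mulrDr -scalerAr ap_linear. Qed.
(** Linear over [A], because the module structure multiplies the argument on the
    other side.  It corresponds to right multiplication on the group algebra. *)
Definition premul x (f : E) : E := mkcoind (premul_lin x f).

Fact premul_linear x : linear (premul x).
Proof. by move=> a f g; apply: coindP => y; rewrite !(apE, apD, apZ) mulrA. Qed.
HB.instance Definition _ x := GRing.isLinear.Build A E E _ (premul x) (premul_linear x).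

Lemma defect_premul j x f : defect j (premul x f) = premul x (defect j f).
Proof. by apply: coindP => y; rewrite defectE !apE mulrA -zC -mulrA. Qed.

(** Membership in W_j. *)
Definition equivariant j (f : E) : Prop := forall l, (l < j)%N -> defect l f = 0.

Fact equivariant0 j : equivariant j 0.
Proof. by move=> l _; exact: linear0. Qed.
Fact equivariantP j a f g : equivariant j f -> equivariant j g -> equivariant j (a *: f + g).
Proof. by move=> Wf Wg l lj; rewrite linearP /= Wf // Wg // scaler0 addr0. Qed.
Definition equivariant_sub j : submodule E := Submodule (@equivariant0 j) (@equivariantP j).

Lemma equivariantS j f : equivariant j.+1 f <-> equivariant j f /\ defect j f = 0.
Proof.
split=> [Wf|[Wf tf] l].
  by split=> [l lj|]; apply: Wf; rewrite ?ltnS // ltnW.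
by rewrite ltnS leq_eqVlt => /predU1P[->//|]; exact: Wf.
Qed.

Lemma equivariantD j f g : equivariant j f -> equivariant j g -> equivariant j (f + g).
Proof. exact: (@smemD _ _ (equivariant_sub j)). Qed.
Lemma equivariantB j f g : equivariant j f -> equivariant j g -> equivariant j (f - g).
Proof.
by move=> Wf Wg; apply: equivariantD => //; exact: (@smemN _ _ (equivariant_sub j)).
Qed.

Lemma equivariant_defect j l f : equivariant j f -> equivariant j (defect l f).
Proof. by move=> Wf i ij; rewrite defectC Wf // linear0. Qed.

Variable d : nat.
Hypothesis defect_onto : forall j, (j < d)%N -> forall f, equivariant j f ->
  exists2 g, equivariant j g & defect j g = f.

(** The exact sequence 0 -> W_(j+1) -> W_j -> W_j -> 0. *)
Lemma equivariant_exact j : (j < d)%N ->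
  exists (i : {linear subm (equivariant_sub j.+1) -> subm (equivariant_sub j)})
    (D : {linear subm (equivariant_sub j) -> subm (equivariant_sub j)}),
    [/\ exact3 i D, forall f, val (i f) = val f & forall f, val (D f) = defect j (val f)].
Proof.
move=> jd.
have [i iP] : exists i : {linear subm (equivariant_sub j.+1) -> subm (equivariant_sub j)},
    forall f, val (i f) = val f.
  apply: (factor_inj (i := (val : {linear subm (equivariant_sub j) -> _}))
    (f := (val : {linear subm (equivariant_sub j.+1) -> _}))); first exact: val_inj.
  move=> f; have [Wf _] := (equivariantS _ _).1 (submP f).
  by exists (Subm (Wf : equivariant_sub j _)).
have [D DP] : exists D : {linear subm (equivariant_sub j) -> subm (equivariant_sub j)},
    forall f, val (D f) = (defect j \o val) f.
  apply: (factor_inj (i := (val : {linear subm (equivariant_sub j) -> _}))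
    (f := (defect j \o (val : {linear subm (equivariant_sub j) -> _})))); first exact: val_inj.
  move=> f; have Wf := equivariant_defect j (submP f).
  by exists (Subm (Wf : equivariant_sub j _)).
exists i, D; split=> //; split.
- by move=> f g fg; apply: val_inj; rewrite -!iP fg.
- move=> f; have [g Wg gf] := defect_onto jd (submP f).
  by exists (Subm (Wg : equivariant_sub j g)); apply: val_inj; rewrite DP.
move=> f; split=> [Df0|[g <-]].
  have Wf : equivariant_sub j.+1 (val f).
    by apply/equivariantS; split; [exact: (submP f) | rewrite -[LHS]/((defect j \o val) f) -DP Df0].
  by exists (Subm Wf); apply: val_inj; rewrite iP.
apply: val_inj; rewrite DP /= iP.
by have [_ ->] := (equivariantS _ _).1 (submP g).
Qed.

Lemma equivariant_coresolvable j : (j <= d)%N ->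
  coresolvable j (subm (equivariant_sub j) : lmodType A).
Proof.
elim: j => [_|j IHj jd].
  apply: (injective_iso (f := (val : {linear subm (equivariant_sub 0) -> _}))).
  - exact: val_inj.
  - by move=> f; have Wf : equivariant_sub 0 f by []; exists (Subm Wf).
  - exact: coind_injective.
have [i [D [iD _ _]]] := equivariant_exact jd.
by apply: (coresolvable_kernel iD); apply: IHj; exact: ltnW.
Qed.

(** Instead of maps into the modules W_j, cochains are maps into [E] with values
    in W_j; the inclusions W_(j+1) -> W_j then disappear. *)
Section Cohomology.
Variables (M : lmodType A) (P : projective_resolution M).

Lemma pr_dd i p : pr_d P i (pr_d P i.+1 p) = 0.
Proof. by apply/pr_exact; exists p. Qed.

Lemma equivariant_lift j i (f : {linear P i -> E}) : (j < d)%N ->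
  (forall p, equivariant j (f p)) ->
  exists g : {linear P i -> E}, (forall p, equivariant j (g p)) /\ forall p, defect j (g p) = f p.
Proof.
move=> jd Wf; have [_ [D [[_ surD _] _ DP]]] := equivariant_exact jd.
have [f' f'P] : exists f' : {linear P i -> subm (equivariant_sub j)}, forall p, val (f' p) = f p.
  apply: (factor_inj (i := (val : {linear subm (equivariant_sub j) -> _})) (f := f)).
    exact: val_inj.
  by move=> p; exists (Subm (Wf p : equivariant_sub j _)).
have [g' g'P] := @pr_projective A M P i _ _ D f' surD.
exists ((val : {linear subm (equivariant_sub j) -> _}) \o g'); split=> p /=.
  exact: (submP (g' p)).
by rewrite -DP g'P f'P.
Qed.

(** Coboundaries of the complex Hom (P, W_j): the cochain that bounds has to take
    its values in W_j as well. *)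
Definition cobound_in j i : (P i -> E) -> Prop :=
  match i return (P i -> E) -> Prop with
  | 0 => fun f => forall p, f p = 0
  | i'.+1 => fun f => exists h : {linear P i' -> E},
      (forall p, equivariant j (h p)) /\ forall p, f p = h (pr_d P i' p)
  end.

Lemma cobound_in0 j i (f : P i -> E) : (forall p, f p = 0) -> cobound_in j f.
Proof.
case: i f => [//|i] f f0 /=; have l0 : linear (fun _ : P i => 0 : E).
  by move=> a x y; rewrite scaler0 addr0.
by exists (lin_of l0); split=> p; [exact: equivariant0 | exact: f0].
Qed.

(** If the defect of [g] is a coboundary, then [g] can be corrected by a
    coboundary to take its values in W_(j+1). *)
Lemma lift_cobound j i (g : {linear P i -> E}) : (j < d)%N ->
  (forall p, equivariant j (g p)) -> cobound_in j (fun p => defect j (g p)) ->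
  exists h : {linear P i -> E},
    (forall p, equivariant j.+1 (h p)) /\ forall p, h (pr_d P i p) = g (pr_d P i p).
Proof.
move=> jd Wg; case: i g Wg => [|i] g Wg /=.
  by move=> g0; exists g; split=> // p; apply/equivariantS.
move=> [c [Wc cP]]; have [c' [Wc' c'P]] := equivariant_lift jd Wc.
exists (g \- (c' \o pr_d P i)); split=> p /=; last by rewrite pr_dd linear0 subr0.
apply/equivariantS; split; first exact: equivariantB.
by rewrite linearB /= cP c'P subrr.
Qed.

End Cohomology.

Section TrivialModule.
Variables (eps : {lrmorphism A -> k^o}) (P : projective_resolution (trivial_module eps)).
Hypothesis eps_z : forall j, eps (z j) = 1.

(** The functionals y |-> eps y v are the elements of Hom (k, W_0). *)
Fact const_lin v : linear (fun y : A => (eps y : k) *: v : V).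
Proof. by move=> a x y; rewrite linearP scalerDl -scalerA. Qed.
Definition const v : E := mkcoind (const_lin v).

Lemma constE v y : ap (const v) y = (eps y : k) *: v.
Proof. by []. Qed.

Lemma constP (c : k) u v : const (c *: u + v) = c%:A *: const u + const v.
Proof.
by apply: coindP => y; rewrite apD apZk !constE scalerDr !scalerA mulrC.
Qed.

Lemma eps_zM j y : eps (z j * y) = eps y.
Proof. by have := rmorphM eps (z j) y; rewrite [X in _ = X * _]eps_z mul1r. Qed.

Lemma defect_const j v : defect j (const v) = const (v - zeta j v).
Proof.
apply: coindP => y; rewrite defectE !constE eps_zM linearZ.
by rewrite -scalerBr.
Qed.

Definition aug (p : P 0) : k := pr_aug P p.

Lemma augP a p q : aug (a *: p + q) = (eps a : k) * aug p + aug q.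
Proof. by rewrite /aug linearP. Qed.

(** The cocycle [f] in degree [j] with values in W_j has the class of [v] in
    Ext^j (k, W_j), where Ext^0 (k, W_0) = V and each step is the connecting map
    Ext^j (k, W_j) -> Ext^(j+1) (k, W_(j+1)): lift the cocycle along the defect to
    [g], and take the coboundary of [g].  As a relation it needs no choice of the
    lift, and is total in both directions. *)
Fixpoint represents j (v : V) : (P j -> E) -> Prop :=
  match j return (P j -> E) -> Prop with
  | 0 => fun f => forall p, f p = const (aug p *: v)
  | j'.+1 => fun f => exists g : {linear P j' -> E},
      [/\ forall p, equivariant j' (g p), represents v (fun p => defect j' (g p))
        & forall p, f p = g (pr_d P j' p)]
  end.

Lemma represents_ext j v (f g : P j -> E) : (forall p, f p = g p) ->
  represents v f -> represents v g.
Proof. by move=> /funext ->. Qed.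

Lemma k_lin (X : lmodType A) (c : k) (f g : X -> E) :
  linear f -> linear g -> linear (fun p => c%:A *: f p + g p).
Proof.
by move=> fl gl a x y; rewrite fl gl !scalerDr scaler_central addrACA.
Qed.

Lemma represents_linear j (c : k) u v (f g : P j -> E) :
  represents u f -> represents v g ->
  represents (c *: u + v) (fun p => c%:A *: f p + g p).
Proof.
elim: j u v f g => [|j IHj] u v f g /=.
  move=> fE gE p; rewrite fE gE -constP; congr const.
  by rewrite scalerDr !scalerA mulrC.
move=> [f' [Wf rf fE]] [g' [Wg rg gE]].
exists (lin_of (k_lin c (linearP f') (linearP g'))); split=> /=.
- by move=> p; exact: equivariantP.
- apply: represents_ext (IHj _ _ _ _ rf rg) => p.
  by rewrite defect_linear.
- by move=> p; rewrite fE gE.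
Qed.

Lemma representsB j u v (f g : P j -> E) : represents u f -> represents v g ->
  represents (u - v) (fun p => f p - g p).
Proof.
move=> rf rg; have := represents_linear (-1) rg rf; rewrite scaleN1r addrC.
by apply: represents_ext => p; rewrite scaleN1r scaleN1r addrC.
Qed.

Lemma represents_defect j l v (f : P j -> E) : represents v f ->
  represents (v - zeta l v) (fun p => defect l (f p)).
Proof.
elim: j f => [|j IHj] f /=.
  move=> fE p; rewrite fE defect_const; congr const.
  by rewrite linearZ -scalerBr.
move=> [g [Wg rg fE]]; exists (defect l \o g); split=> [p|/=|p] /=.
- exact: equivariant_defect.
- by apply: represents_ext (IHj _ rg) => p; rewrite defectC.
- by rewrite fE.
Qed.

(** The scalar [eps x] arises in degree 0, where [x] multiplies the argument of
    y |-> eps y v; every later step commutes with [premul]. *)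
Lemma represents_premul j x v (f : P j -> E) : represents v f ->
  represents ((eps x : k) *: v) (fun p => premul x (f p)).
Proof.
elim: j f => [|j IHj] f /=.
  move=> fE p; rewrite fE; apply: coindP => y; rewrite !(apE, constE) rmorphM.
  by rewrite !scalerA -[_ * _ * aug p]mulrA [eps x * _]mulrC.
move=> [g [Wg rg fE]]; exists (premul x \o g); split=> [p l lj|/=|p] /=.
- by rewrite defect_premul Wg // linear0.
- by apply: represents_ext (IHj _ rg) => p; rewrite defect_premul.
- by rewrite fE.
Qed.

Lemma represents_cocycle j v (f : P j -> E) : represents v f ->
  [/\ linear f, forall p, equivariant j (f p) & forall p, f (pr_d P j p) = 0].
Proof.
elim: j f => [|j IHj] f /=.
  move=> fE; split=> // [a p q|p].
    rewrite !fE; apply: coindP => y; rewrite apD apZ !constE augP rmorphM.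
    by rewrite scalerDl scalerDr !scalerA mulrA.
  rewrite fE /aug (_ : pr_aug P _ = 0); last by apply/pr_exact0; exists p.
  by apply: coindP => y; rewrite constE !scale0r scaler0.
move=> [g [Wg /IHj[_ _ gd0] fE]]; split=> [a p q|p|p].
- by rewrite !fE !linearP.
- by rewrite fE; apply/equivariantS.
- by rewrite fE pr_dd linear0.
Qed.

Lemma represents_total j v : (j <= d)%N -> exists f : {linear P j -> E}, represents v f.
Proof.
elim: j => [_|j IHj jd].
  have rf : represents (j := 0) v (fun p : P 0 => const (aug p *: v)) by [].
  by have [fl _ _] := represents_cocycle rf; exists (lin_of fl).
have [f rf] := IHj (ltnW jd); have [_ Wf _] := represents_cocycle rf.
have [g [Wg gE]] := equivariant_lift jd Wf.
exists (g \o pr_d P j) => /=; exists g; split=> //.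
by apply: represents_ext rf => p; rewrite gE.
Qed.

(** [q j] stands for the projection of [V] onto its quotient by the images of
    id - zeta_l for l < j; only its kernel matters.  The hypothesis [q_inj] says
    that the operators id - zeta_l form a regular sequence. *)
Variable q : nat -> V -> V.
Hypothesis q0 : forall v, q 0 v = 0 <-> v = 0.
Hypothesis q_inj : forall j v, (j < d)%N -> q j (v - zeta j v) = 0 -> q j v = 0.
Hypothesis qS : forall j v, (j < d)%N ->
  q j.+1 v = 0 <-> exists u, q j (v - (u - zeta j u)) = 0.

Definition cocycle_in j i (f : P i -> E) : Prop :=
  (forall p, equivariant j (f p)) /\ (forall p, f (pr_d P i p) = 0).

(** The long exact sequences of 0 -> W_(j+1) -> W_j -> W_j -> 0, by induction on
    [j]: Ext^i (k, W_j) is 0 for i <> j, and the map from [V] to Ext^j (k, W_j) is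
    onto with kernel that of [q j].  The three claims feed each other, and so are
    proved together. *)
Lemma cohomology j : (j <= d)%N ->
  [/\ forall i (f : {linear P i -> E}), i != j -> cocycle_in j f -> cobound_in j f,
      forall f : {linear P j -> E}, cocycle_in j f -> exists v, represents v f
    & forall v (f : {linear P j -> E}), represents v f -> (cobound_in j f <-> q j v = 0)].
Proof.
elim: j => [_|j IHj jd].
  split.
  - case=> // i f _ [_ fd0].
    have [h hP] : exists h : {linear P i -> E}, forall p, h (pr_d P i p) = f p.
      by apply: inj_extend => [|p /pr_exact[p' <-]//]; exact: coind_injective.
    by exists h; split=> // p; rewrite hP.
  - move=> f [_ fd0].
    have [h hP] : exists h : {linear trivial_module eps -> E},
        forall p, h (pr_aug P p) = f p.
      by apply: factor_surj => [x|p /pr_exact0[p' <-]//]; exact: pr_surj.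
    pose e : trivial_module eps := (1 : k^o).
    exists (ap (h e) 1) => p /=; apply: coindP => y.
    rewrite constE scalerA -[y in LHS]mul1r -apZ -hP -linearZ /=.
    have -> : y *: pr_aug P p = ((eps y : k) * aug p)%:A *: e.
      by rewrite !trivZ eps_scalar [RHS]mulr1.
    by rewrite linearZ apZk.
  - move=> v f /= rf; rewrite q0; split=> [f0|v0 p]; last first.
      by rewrite rf v0 scaler0; apply: coindP => y; rewrite constE scaler0.
    have [p pE] := pr_surj P (1 : k^o).
    have := f0 p; rewrite rf /aug pE => /(congr1 (fun f => ap f 1)).
    by rewrite constE rmorph1 !scale1r.
have [van onto cob] := IHj (ltnW jd).
have down i (f : P i -> E) : cocycle_in j.+1 f -> cocycle_in j f /\ forall p, defect j (f p) = 0.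
  move=> [Wf fd0]; split; first split=> // p.
    by have [] := (equivariantS _ _).1 (Wf p).
  by move=> p; have [] := (equivariantS _ _).1 (Wf p).
(* Ext^(i-1) (k, W_j) -> Ext^i (k, W_(j+1)) -> Ext^i (k, W_j), where the group
   on the left is 0 unless [i = j.+1]. *)
have up i (f : {linear P i -> E}) :
    cocycle_in j.+1 f -> cobound_in j f -> i != j.+1 -> cobound_in j.+1 f.
  move=> /down[_ twf0]; case: i f twf0 => [//|i] f twf0 [g [Wg fE]] ij.
  have gc : cobound_in j (defect j \o g).
    apply: van => //; split=> p /=; first exact: equivariant_defect.
    by rewrite -fE.
  have [h [Wh hE]] := lift_cobound jd Wg gc.
  by exists h; split=> // p; rewrite hE.
split.
- move=> i f ij fc; apply: up => //; have [fc' twf0] := down _ _ fc.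
  have [ij'|] := eqVneq i j; last by move=> ij'; exact: van.
  move: f fc fc' twf0; rewrite ij' => f fc fc' twf0.
  (* In degree [j] regularity makes Ext^j (k, W_(j+1)) -> Ext^j (k, W_j) zero. *)
  have [v rf] := onto f fc'; apply/(cob v) => //; apply: q_inj => //.
  apply/(cob _ (defect j \o f)); first exact: represents_defect.
  exact: cobound_in0.
- move=> f /down[fc twf0].
  have [//|g [Wg fE]] := van _ f _ fc; first by rewrite gtn_eqF.
  have [v rv] : exists v, represents v (defect j \o g).
    apply: onto; split=> p /=; first exact: equivariant_defect.
    by rewrite -fE.
  by exists v, g.
move=> v f [g [Wg rg fE]]; rewrite qS //; split.
  move=> [h [Wh hE]].
  have [u ru] : exists u, represents u (g \- h).
    apply: onto; split=> p /=; last by rewrite -fE hE subrr.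
    by apply: equivariantB => //; have [] := (equivariantS _ _).1 (Wh p).
  exists u; apply/(cob _ ((defect j \o g) \- (defect j \o (g \- h)))).
    exact: representsB rg (represents_defect j ru).
  apply: cobound_in0 => p /=; rewrite linearB /= opprB addrC subrK.
  by have [] := (equivariantS _ _).1 (Wh p).
move=> [u qu].
have [f' rf'] := represents_total u (ltnW jd).
have [_ Wf' fd0'] := represents_cocycle rf'.
have Wgf p : equivariant j ((g \- f') p) by exact: equivariantB.
have rgf : represents (v - (u - zeta j u)) (defect j \o (g \- f')).
  by apply: represents_ext (representsB rg (represents_defect j rf')) => p /=; rewrite linearB.
have := (cob _ _ rgf).2 qu; move=> /(lift_cobound jd Wgf)[h [Wh hE]].
by exists h; split=> // p; rewrite fE hE /= fd0' subr0.
Qed.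

End TrivialModule.
End EquivariantFunctions.

(** * The group algebra of a lattice *)

Section Lattice.
Variables (k : fieldType) (d : nat).

Definition lattice : Type := {ffun 'I_d -> int}.
HB.instance Definition _ := GRing.Zmodule.on lattice.

Local Notation V := {malg k[lattice]}.

(** Indexed by natural numbers, with value 0 for [d <= j], to match the indexing
    of the modules W_j. *)
Definition unit_vec (j : nat) : lattice := [ffun i : 'I_d => (nat_of_ord i == j)%:Z].

Lemma lattice_gen (Q : lattice -> Prop) : Q 0 ->
  (forall a b, Q a -> Q b -> Q (a + b)) -> (forall a, Q a -> Q (- a)) ->
  (forall j, (j < d)%N -> Q (unit_vec j)) -> forall a, Q a.
Proof.
move=> Q0 QD QN Qe a.
have -> : a = \sum_(i < d) unit_vec i *~ a i.
  apply/ffunP => j; rewrite sum_ffunE (bigD1 j) //= big1 => [|i ij].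
    by rewrite ffunMzE ffunE eqxx intz addr0.
  by rewrite ffunMzE ffunE [_ == _]eq_sym [_ == _](negPf ij) mul0rz.
apply: (big_ind Q) => // i _; have Qn n : Q (unit_vec i *+ n).
  by elim: n => [|n IHn]; rewrite ?mulr0n // mulrS; apply: QD => //; exact: Qe.
by case: (a i) => n; [exact: Qn | exact/QN/Qn].
Qed.

Definition shift (a : lattice) : V -> V := flift (fun b => << a + b >>).
HB.instance Definition _ a := GRing.Linear.on (shift a).

Lemma shiftU a b : shift a << b >> = << a + b >>.
Proof. by rewrite /shift fliftU scale1r. Qed.

Lemma shift0 v : shift 0 v = v.
Proof.
apply: (free_ext (f := shift 0) (g := idfun)) => b /=.
by rewrite shiftU add0r.
Qed.

Lemma shiftD a b v : shift (a + b) v = shift a (shift b v).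
Proof.
apply: (free_ext (f := shift (a + b)) (g := shift a \o shift b)) => c /=.
by rewrite !shiftU addrA.
Qed.

Lemma shiftC a b v : shift a (shift b v) = shift b (shift a v).
Proof. by rewrite -!shiftD addrC. Qed.

Lemma shift_coef a b v : (shift a v)@_(a + b) = v@_b.
Proof.
have fl : linear (fun v : V => (shift a v)@_(a + b) : k^o).
  by move=> c x y; rewrite linearP mcoeffD mcoeffZ.
have gl : linear (fun v : V => v@_b : k^o).
  by move=> c x y; rewrite mcoeffD mcoeffZ.
apply: (free_ext (f := lin_of fl) (g := lin_of gl)) => c /=.
by rewrite shiftU !mcoeffU (inj_eq (addrI a)).
Qed.

Definition trunc (j : nat) (a : lattice) : lattice :=
  [ffun i : 'I_d => if (i < j)%N then 0 else a i].

(** The quotient of k[Z^d] by the differences v - z_l v for l < j is k[Z^(d-j)],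
    realised here as the span of the lattice points whose first [j] coordinates
    vanish. *)
Definition tproj j : V -> V := flift (fun a => << trunc j a >>).
HB.instance Definition _ j := GRing.Linear.on (tproj j).

Lemma tprojU j a : tproj j << a >> = << trunc j a >>.
Proof. by rewrite /tproj fliftU scale1r. Qed.

Lemma tproj0 v : tproj 0 v = v.
Proof.
apply: (free_ext (f := tproj 0) (g := idfun)) => b /=; rewrite tprojU.
by congr (<< _ >>); apply/ffunP => i; rewrite ffunE ltn0.
Qed.

Lemma tprojS j v : tproj j.+1 (tproj j v) = tproj j.+1 v.
Proof.
apply: (free_ext (f := tproj j.+1 \o tproj j) (g := tproj j.+1)) => a /=.
rewrite !tprojU; congr (<< _ >>); apply/ffunP => i; rewrite !ffunE ltnS leq_eqVlt.
by case: eqP => //= _; case: ltnP.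
Qed.

Lemma tproj_shiftS j v : tproj j.+1 (shift (unit_vec j) v) = tproj j.+1 v.
Proof.
apply: (free_ext (f := tproj j.+1 \o shift (unit_vec j)) (g := tproj j.+1)) => a /=.
rewrite shiftU !tprojU; congr (<< _ >>); apply/ffunP => i; rewrite !ffunE.
by case: ltnP => // ij; rewrite gtn_eqF // add0r.
Qed.

Lemma tproj_shift j v : tproj j (shift (unit_vec j) v) = shift (unit_vec j) (tproj j v).
Proof.
apply: (free_ext (f := tproj j \o shift (unit_vec j))
                 (g := shift (unit_vec j) \o tproj j)) => a /=.
rewrite !(shiftU, tprojU); congr (<< _ >>); apply/ffunP => i; rewrite !ffunE.
by case: ltnP => // ij; rewrite ltn_eqF.
Qed.

Lemma tproj_all v : exists c, tproj d v = c *: << 0 >>.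
Proof.
rewrite [v]monalgE linear_sum /=; elim/big_rec: _ => [|a x _ [c cE]].
  by exists 0; rewrite scale0r.
have a0 : trunc d a = 0 by apply/ffunP => i; rewrite !ffunE ltn_ord.
by exists (v@_a + c); rewrite cE malgUZ linearZ /= tprojU scalerDl a0.
Qed.

(** A nonzero translation moves every finite support: the coordinates of the
    support are bounded, while those of [b + n unit_vec j] are not. *)
Lemma shift_fix j v : (j < d)%N -> shift (unit_vec j) v = v -> v = 0.
Proof.
move=> jd vE; apply/malgP => b; rewrite mcoeff0; apply/eqP.
apply: contraT => vb; pose i := Ordinal jd.
have [B BP] : exists B : int, forall x, x \in msupp v -> x i <= B.
  exists (\sum_(y <- msupp v) `|y i|) => x xv; apply: le_trans (ler_norm _) _.
  by rewrite (big_fsetD1 _ xv) /= lerDl sumr_ge0.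
have vn n : v@_(unit_vec j *+ n + b) != 0.
  elim: n => [|n IHn]; first by rewrite mulr0n add0r.
  by rewrite mulrS -addrA -{1}vE shift_coef.
have := vn (absz (B - b i)).+1; rewrite mcoeff_neq0 => /BP.
by rewrite ffunE ffunMnE ffunE eqxx natz; move: (b _) => y; lia.
Qed.

Lemma tproj_inj j v : (j < d)%N -> tproj j (v - shift (unit_vec j) v) = 0 -> tproj j v = 0.
Proof.
move=> jd /eqP; rewrite linearB /= tproj_shift subr_eq0 eq_sym => /eqP.
exact: shift_fix.
Qed.

(** Modulo the image of id - z_j, the j-th coordinate can be changed at will. *)
Lemma telescope j a n : exists u,
  << a >> - << a + unit_vec j *~ n >> = u - shift (unit_vec j) u.
Proof.
have tel (m : nat) b : exists u, << b >> - << b + unit_vec j *+ m >> = u - shift (unit_vec j) u.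
  elim: m b => [|m IHm] b; first by exists 0; rewrite linear0 mulr0n addr0 !subrr.
  have [u uE] := IHm (unit_vec j + b); exists (<< b >> + u).
  rewrite linearD /= shiftU opprD addrACA -uE mulrS addrA [b + _]addrC.
  by rewrite addrA subrK.
case: n => m; first exact: tel.
have [u uE] := tel m.+1 (a - unit_vec j *+ m.+1); exists (- u).
by rewrite linearN /= -opprD -uE opprB subrK NegzE mulrNz.
Qed.

Lemma tproj_step j v : (j < d)%N ->
  tproj j.+1 v = 0 <-> exists u, tproj j (v - (u - shift (unit_vec j) u)) = 0.
Proof.
move=> jd; split=> [v0|[u /(congr1 (tproj j.+1))]]; last first.
  by rewrite tprojS !linearB /= tproj_shiftS subrr addr0 linear0.
pose D : {linear V -> V} := tproj j \- tproj j.+1.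
pose S : {linear V -> V} := tproj j \o (idfun \- shift (unit_vec j)).
have : exists u, D v = S u.
  rewrite [v]monalgE; elim/big_rec: _ => [|a x _ [u uE]].
    by exists 0; rewrite !linear0.
  have [u' u'E] := telescope j a (- a (Ordinal jd)).
  exists (v@_a *: u' + u); rewrite malgUZ linearP [RHS]linearP uE.
  suff aE : trunc j.+1 a = trunc j (a + unit_vec j *~ - a (Ordinal jd)).
    congr (_ *: _ + _); rewrite -[RHS]/(tproj j (u' - shift (unit_vec j) u')).
    by rewrite -u'E linearB /= !tprojU aE.
  apply/ffunP => i; rewrite !ffunE ffunMzE ffunE ltnS leq_eqVlt.
  case: eqP => [ij|] /=; last by case: ltnP; rewrite // mul0rz addr0.
  by case: ltnP => // _; rewrite mulrNz intz (_ : Ordinal jd = i) ?subrr //; apply: val_inj.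
by rewrite /D /S /= v0 subr0 => -[u uE]; exists u; rewrite linearB /= uE subrr.
Qed.

End Lattice.

(** * Group algebras as equivariant functions *)

Section IndefiniteSum.
Variable V : zmodType.

(** The solution of F (n + 1) - F n = s n with F 0 = 0. *)
Definition isum (s : int -> V) (n : int) : V :=
  match n with
  | Posz n => \sum_(i < n) s i
  | Negz n => - \sum_(i < n.+1) s (Negz i)
  end.

Lemma isumS s n : isum s (n + 1) = isum s n + s n.
Proof.
case: n => [n|[|n]].
- by rewrite -PoszD addn1 /= big_ord_recr.
- by rewrite /= big_ord0 big_ord1 addNr.
have -> : Negz n.+1 + 1 = Negz n by lia.
by rewrite /= [X in _ = - X + _]big_ord_recr /= opprD -addrA addNr addr0.
Qed.

End IndefiniteSum.

Lemma isum_additive (V W : zmodType) (f : {additive V -> W}) s n :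
  isum (fun i => f (s i)) n = f (isum s n).
Proof. by case: n => n; rewrite /= ?(raddfN f) (raddf_sum f). Qed.

(** An algebra with a basis [e] that multiplies as the group, given together with
    its coordinates, and a finite-index lattice [alpha] in the center of the
    group. *)
Section GroupLike.
Variables (k : fieldType) (G : groupType) (A : algType k) (e : G -> A).
Hypothesis eM : forall g h, e g * e h = e (g * h)%g.
Hypothesis e1 : e 1%g = 1.
Variable coord : {linear A -> {malg k[G]}}.
Hypothesis coordK : cancel coord (flift e).
Hypothesis coord_e : forall g, coord (e g) = << g >>.

Lemma basis_ext (W : lmodType k) (f g : A -> W) : linear f -> linear g ->
  (forall h, f (e h) = g (e h)) -> forall x, f x = g x.
Proof.
move=> fl gl fg x; rewrite -[x]coordK.
apply: (free_ext (f := lin_of fl \o flift e) (g := lin_of gl \o flift e)) => h /=.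
by rewrite fliftU scale1r.
Qed.

Definition extend (W : lmodType k) (h : G -> W) : A -> W := flift h \o coord.
HB.instance Definition _ (W : lmodType k) (h : G -> W) := GRing.Linear.on (extend h).

Lemma extendE (W : lmodType k) (h : G -> W) g : extend h (e g) = h g.
Proof. by rewrite /extend /= coord_e fliftU scale1r. Qed.

Variable d : nat.
Local Notation L := (lattice d).
Local Notation V := {malg k[lattice d]}.

Variable alpha : L -> G.
Hypothesis alphaD : forall a b, alpha (a + b) = (alpha a * alpha b)%g.
Hypothesis alpha_inj : injective alpha.
Hypothesis alphaC : forall a, central (alpha a).

Lemma alpha0 : alpha 0 = 1%g.
Proof. by apply: (@mulgI _ (alpha 0)); rewrite -alphaD mulg1 addr0. Qed.

Lemma alphaN a : alpha (- a) = (alpha a)^-1%g.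
Proof. by apply: (@mulgI _ (alpha a)); rewrite -alphaD mulgV subrr alpha0. Qed.

Lemma e_alphaC a x : e (alpha a) * x = x * e (alpha a).
Proof.
move: x; apply: basis_ext => [||g].
- exact: (mul_bilin A).2.
- exact: (mul_bilin A).1.
- by rewrite !eM alphaC.
Qed.

Definition lattice_elt (g : G) : V :=
  if pselect (exists a, alpha a = g) is left h then << projT1 (cid h) >> else 0.

Lemma lattice_elt_alpha a : lattice_elt (alpha a) = << a >>.
Proof.
rewrite /lattice_elt; case: pselect => [h|[]]; last by exists a.
by case: (cid h) => b /= /alpha_inj ->.
Qed.

Lemma lattice_elt_out g : ~ (exists a, alpha a = g) -> lattice_elt g = 0.
Proof. by rewrite /lattice_elt; case: pselect. Qed.

Lemma lattice_elt_mul a g : lattice_elt (alpha a * g)%g = shift a (lattice_elt g).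
Proof.
have [[b <-]|gA] := pselect (exists b, alpha b = g).
  by rewrite -alphaD !lattice_elt_alpha shiftU.
rewrite !lattice_elt_out ?linear0 // => -[b bE]; apply: gA; exists (b - a).
by rewrite addrC alphaD bE alphaN mulKg.
Qed.

(** If [g h] is central, then [h g = g^-1 (g h) g] equals [g h]. *)
Lemma lattice_eltC g h : lattice_elt (g * h)%g = lattice_elt (h * g)%g.
Proof.
suff aux x y a : alpha a = (x * y)%g -> alpha a = (y * x)%g.
  have [[a aE]|gA] := pselect (exists a, alpha a = (g * h)%g).
    by rewrite -aE -(aux _ _ _ aE).
  rewrite !lattice_elt_out // => -[a aE]; apply: gA; exists a; exact: aux.
move=> aE; apply: (@mulgI _ x); rewrite mulgA -aE; exact/esym/alphaC.
Qed.

(** The projection pi from the group algebra to that of the lattice. *)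
Definition lattice_part : A -> V := extend lattice_elt.
HB.instance Definition _ := GRing.Linear.on lattice_part.

Lemma lattice_part_e g : lattice_part (e g) = lattice_elt g. Proof. exact: extendE. Qed.

Lemma lattice_part_alpha a y : lattice_part (e (alpha a) * y) = shift a (lattice_part y).
Proof.
move: y; apply: basis_ext => [||g].
- by apply: lin_comp (linearP lattice_part) _; exact: (mul_bilin A).2.
- exact: lin_comp (linearP (shift a)) (linearP lattice_part).
- by rewrite eM !lattice_part_e lattice_elt_mul.
Qed.

Lemma lattice_partC x y : lattice_part (x * y) = lattice_part (y * x).
Proof.
move: x; apply: basis_ext => [||g].
- by apply: lin_comp (linearP lattice_part) _; exact: (mul_bilin A).1.
- by apply: lin_comp (linearP lattice_part) _; exact: (mul_bilin A).2.
move: y; apply: basis_ext => [||h].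
- by apply: lin_comp (linearP lattice_part) _; exact: (mul_bilin A).2.
- by apply: lin_comp (linearP lattice_part) _; exact: (mul_bilin A).1.
by rewrite !eM !lattice_part_e lattice_eltC.
Qed.

Definition gen (j : nat) : A := e (alpha (unit_vec d j)).
Definition gen_shift (j : nat) : {linear V -> V} := shift (unit_vec d j).

Lemma genC j x : gen j * x = x * gen j.
Proof. exact: e_alphaC. Qed.

Lemma gen_shiftC i j v : gen_shift i (gen_shift j v) = gen_shift j (gen_shift i v).
Proof. by rewrite /gen_shift /= -!shiftD addrC. Qed.

Local Notation E := (coind A V).
Local Notation defect := (defect gen gen_shift).
Local Notation equivariant := (equivariant gen gen_shift).

Lemma equivariantE j (f : E) :
  equivariant j f <-> forall l, (l < j)%N -> forall y, ap f (gen l * y) = gen_shift l (ap f y).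
Proof.
split=> [Wf l lj y|Wf l lj].
  by apply/eqP; rewrite -subr_eq0 -defectE Wf // ap0.
by apply: coindP => y; rewrite defectE Wf // subrr.
Qed.

Lemma equivariant_alpha (f : E) : equivariant d f ->
  forall a y, ap f (e (alpha a) * y) = shift a (ap f y).
Proof.
move=> /equivariantE Wf; apply: lattice_gen.
- by move=> y; rewrite alpha0 e1 mul1r shift0.
- by move=> a b IHa IHb y; rewrite alphaD -eM -mulrA IHa IHb shiftD.
- move=> a IHa y; rewrite -[y in RHS]mul1r -e1 -(mulgV (alpha a)) -eM -mulrA IHa.
  by rewrite -shiftD addNr shift0 alphaN.
- by move=> j jd y; rewrite Wf.
Qed.

(** Right multiplication by [n] followed by pi; the form pi (y n) is the one that
    makes [lattice_part] a Frobenius form over the lattice. *)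
Definition theta_fun (n : A) : E := mkcoind (lin_comp (linearP lattice_part) ((mul_bilin A).1 n)).

Lemma thetaE n y : ap (theta_fun n) y = lattice_part (y * n).
Proof. by []. Qed.

Fact theta_linear : linear (theta_fun : A^o -> E).
Proof.
move=> a x y; apply: coindP => u; rewrite apD apZ !thetaE mulrDr.
by rewrite -[a *: x]/(a * x) mulrA linearD.
Qed.
Definition theta : {linear A^o -> E} := lin_of theta_linear.

Lemma theta_equivariant n : equivariant d (theta n).
Proof. by apply/equivariantE => l _ y; rewrite !thetaE -mulrA lattice_part_alpha. Qed.

(** The coefficient of the unit in pi (g^-1 n) is the coefficient of [g] in
    [n]. *)
Lemma coord_theta n g : (coord n)@_g = (ap (theta n) (e g^-1%g))@_0.
Proof.
rewrite thetaE; move: n; apply: (basis_ext (W := k^o)) => [||h].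
- by move=> c x y; rewrite linearP mcoeffD mcoeffZ.
- by move=> c x y; rewrite mulrDr -scalerAr linearP mcoeffD mcoeffZ.
rewrite coord_e eM lattice_part_e mcoeffU.
have [->|gh] := eqVneq h g; first by rewrite mulVg -alpha0 lattice_elt_alpha mcoeffUU.
rewrite /lattice_elt; case: pselect => [[a aE]|_]; last by rewrite mcoeff0.
case: (cid _) => b /= bE; rewrite mcoeffU; have [b0|//] := eqVneq b 0.
by case/eqP: gh; apply: (@mulgI _ g^-1%g); rewrite mulVg -bE b0 alpha0.
Qed.

Lemma theta_inj : injective theta.
Proof.
move=> n n' nn'; rewrite -[n]coordK -[n']coordK; congr (flift e _).
by apply/malgP => g; rewrite !coord_theta nn'.
Qed.

Variable reps : seq G.
Hypothesis reps_cover : forall g, exists2 r, r \in reps & exists a, g = (alpha a * r)%g.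

(** [xget] depends only on the set that it chooses from, so that two elements of
    the same coset of the lattice get the same representative. *)
Definition orbit_rep (g : G) : G := xget 1%g [set h | exists a, g = (alpha a * h)%g]%classic.

Lemma orbit_repP g : exists a, g = (alpha a * orbit_rep g)%g.
Proof.
rewrite /orbit_rep; case: xgetP => [h _ //|/(_ g)[]].
by exists 0; rewrite alpha0 mul1g.
Qed.

Lemma orbit_rep_alpha a g : orbit_rep (alpha a * g)%g = orbit_rep g.
Proof.
congr (xget _ _); apply/seteqP; split=> h /= [b bE]; last first.
  by exists (a + b); rewrite alphaD -mulgA -bE.
by exists (- a + b); rewrite alphaD -mulgA -bE alphaN mulKg.
Qed.

Lemma orbit_rep_idem g : orbit_rep (orbit_rep g) = orbit_rep g.
Proof. by have [a {2}->] := orbit_repP g; rewrite orbit_rep_alpha. Qed.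

Definition orbit_coord (g : G) : L := projT1 (cid (orbit_repP g)).

Lemma orbit_coordP g : g = (alpha (orbit_coord g) * orbit_rep g)%g.
Proof. by rewrite /orbit_coord; case: cid. Qed.

Lemma orbit_coord_alpha a g : orbit_coord (alpha a * g)%g = a + orbit_coord g.
Proof.
apply/alpha_inj/(@mulIg _ (orbit_rep g)).
rewrite -{1}(orbit_rep_alpha a) -orbit_coordP alphaD -mulgA.
by rewrite -orbit_coordP.
Qed.

Definition lattice_incl : V -> A := flift (fun a => e (alpha a)).
HB.instance Definition _ := GRing.Linear.on lattice_incl.

Lemma lattice_part_incl_alpha a v : lattice_part (e (alpha a) * lattice_incl v) = shift a v.
Proof.
rewrite lattice_part_alpha; congr shift.
apply: (free_ext (f := lattice_part \o lattice_incl) (g := idfun)) => b /=.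
by rewrite /lattice_incl fliftU scale1r lattice_part_e lattice_elt_alpha.
Qed.

Lemma lattice_part_incl_out g v : ~ (exists a, alpha a = g) ->
  lattice_part (e g * lattice_incl v) = 0.
Proof.
move=> gA; have fl : linear (fun v => lattice_part (e g * lattice_incl v)).
  by move=> c x y; rewrite linearP mulrDr -scalerAr linearP.
have l0 : linear (fun _ : V => 0 : V) by move=> c x y; rewrite scaler0 addr0.
apply: (free_ext (f := lin_of fl) (g := lin_of l0)) => b /=.
rewrite /lattice_incl fliftU scale1r eM lattice_part_e lattice_elt_out // => -[a aE].
apply: gA; exists (a - b); apply: (@mulIg _ (alpha b)).
by rewrite -alphaD subrK.
Qed.

(** An equivariant [f] is determined by its values on a transversal [T], and it is
    the image of the sum of r^-1 f (r) over r in [T]: for [g = alpha a * r] every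
    other representative contributes 0 to pi (g n). *)
Lemma theta_onto (f : E) : equivariant d f -> exists n : A^o, theta n = f.
Proof.
move=> Wf; pose T := undup [seq orbit_rep r | r <- reps].
have TP g : orbit_rep g \in T.
  rewrite mem_undup; apply/mapP; have [r rT [a ->]] := reps_cover g.
  by exists r; rewrite ?orbit_rep_alpha.
exists (\sum_(r <- T) e r^-1%g * lattice_incl (ap f (e r))); apply: coindP.
apply: basis_ext => [||g]; [exact: ap_linear | exact: ap_linear |].
rewrite thetaE mulr_sumr linear_sum (bigD1_seq _ (TP g) (undup_uniq _)) /=.
have gE := orbit_coordP g; rewrite big1_seq => [|r /andP[rg rT]].
  rewrite addr0 mulrA eM {1}gE mulgK lattice_part_incl_alpha.
  by rewrite -equivariant_alpha // eM -gE.
rewrite mulrA eM lattice_part_incl_out // => -[a aE]; case/eqP: rg.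
have rr : orbit_rep r = r.
  by move: rT; rewrite mem_undup => /mapP[x _ ->]; exact: orbit_rep_idem.
by rewrite -rr -(orbit_rep_alpha a) aE mulgVK.
Qed.

(** Solve f' (z_j y) - z_j f' (y) = f (y).  On the orbit of [g] under z_j, write
    f' (z_j^n g) = z_j^n F (n); the equation becomes
    F (n + 1) - F (n) = z_j^(-n-1) f (z_j^n g), which [isum] solves.  The point
    [base g] of the orbit where the j-th coordinate is 0 serves as its origin. *)
Lemma defect_onto j : (j < d)%N -> forall f, equivariant j f ->
  exists2 g, equivariant j g & defect j g = f.
Proof.
move=> jd f /equivariantE Wf; pose u := unit_vec d j; pose i := Ordinal jd.
pose n g : int := orbit_coord g i.
pose base g := (alpha (- (u *~ n g)) * g)%g.
pose s g (m : int) := shift (- (u *~ (m + 1))) (ap f (e (alpha (u *~ m)) * e (base g))).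
pose h g := shift (u *~ n g) (isum (s g) (n g)).
have hg g : ap (mkcoind (linearP (extend h))) (e g) = h g by exact: extendE.
have nE l g : n (alpha (unit_vec d l) * g)%g = (j == l)%:Z + n g.
  by rewrite /n orbit_coord_alpha ffunE ffunE.
have nS g : n (alpha u * g)%g = n g + 1 by rewrite nE eqxx addrC.
have hj g : h (alpha u * g)%g = shift u (h g) + ap f (e g).
  have baseE : base (alpha u * g)%g = base g.
    rewrite /base nS mulgA -alphaD; congr (alpha _ * _)%g.
    by rewrite mulrzDr mulr1z opprD subrK.
  have sE : s (alpha u * g)%g = s g by rewrite /s baseE.
  have uS m : u *~ (m + 1) = u + u *~ m by rewrite mulrzDr mulr1z addrC.
  rewrite /h nS sE isumS (linearD (shift _)) /= uS shiftD.
  congr (_ + _); rewrite /s -shiftD uS subrr shift0 eM /base mulgA -alphaD.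
  by rewrite subrr alpha0 mul1g.
have hl l g : (l < j)%N -> h (alpha (unit_vec d l) * g)%g = gen_shift l (h g).
  move=> lj; have nlg : n (alpha (unit_vec d l) * g)%g = n g by rewrite nE gtn_eqF // add0r.
  rewrite /h nlg.
  (* The solution depends linearly on [f], so it inherits the first [j]
   equations. *)
  have -> : s (alpha (unit_vec d l) * g)%g = fun m => gen_shift l (s g m).
    apply/funext => m; rewrite /s /base nlg [RHS](shiftC (unit_vec d l)).
    congr (shift _); rewrite -[RHS]/(gen_shift l _) -Wf //; congr (ap f _).
    rewrite /gen !eM !mulgA -!alphaD; congr (e (alpha _ * _)%g).
    by rewrite addrC addrA.
  by rewrite isum_additive [RHS](shiftC (unit_vec d l)).
exists (mkcoind (linearP (extend h))).
  apply/equivariantE => l lj; apply: basis_ext => [||g].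
  - exact: lin_comp (@ap_linear _ _ _ _) ((mul_bilin A).2 _).
  - exact: lin_comp (linearP (gen_shift l)) (@ap_linear _ _ _ _).
  - by rewrite eM !hg hl.
apply: coindP; apply: basis_ext => [||g]; try exact: ap_linear.
by rewrite defectE eM !hg hj addrC addKr.
Qed.


Section Gorenstein.
Variable eps : {lrmorphism A -> k^o}.
Hypothesis eps_e : forall g, eps (e g) = 1.

Lemma eps_gen j : eps (gen j) = 1. Proof. exact: eps_e. Qed.

Lemma theta_factor (X : lmodType A) (f : {linear X -> E}) :
  (forall x, equivariant d (f x)) -> exists h : {linear X -> A^o}, forall x, theta (h x) = f x.
Proof. by move=> Wf; apply: factor_inj => [|x]; [exact: theta_inj | exact: (theta_onto (Wf x))]. Qed.

Section Resolution.
Variable P : projective_resolution (trivial_module eps).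
Local Notation represents := (represents gen gen_shift (eps := eps)).
Local Notation cobound_in := (cobound_in gen gen_shift).

Lemma coboundaryE i (f : P i -> A^o) : linear f ->
  is_coboundary (P := P) (N := regular_bimodule A) f <-> cobound_in d (theta \o f).
Proof.
case: i f => [|i] f fl.
  split=> [-> p|f0]; first exact: (linear0 theta).
  apply/funext => p; apply: theta_inj; rewrite [LHS]f0; exact/esym/(linear0 theta).
split=> [[g gl ->]|[h [Wh hE]]].
  exists (theta \o lin_of gl); split=> // p; exact: theta_equivariant.
have [g gE] := theta_factor Wh; exists g; first exact: linearP.
by apply/funext => p; apply: theta_inj; rewrite gE -hE.
Qed.

Let coh := cohomology genC gen_shiftC defect_onto P eps_gen
  (fun v => eq_ind_r (fun w => w = 0 <-> v = 0) (iff_refl _) (tproj0 v))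
  (@tproj_inj k d) (@tproj_step k d) (leqnn d).

Lemma theta_cocycle i (f : P i -> A^o) :
  is_cocycle (P := P) (N := regular_bimodule A) f -> cocycle_in gen gen_shift d (theta \o f).
Proof.
move=> [_ f0]; split=> p; first exact: theta_equivariant.
by rewrite /= [f _]f0; exact: (linear0 theta).
Qed.

Lemma ext_vanish i (x : Ext_of P (regular_bimodule A) i) : i != d -> x = 0.
Proof.
move=> id_; elim/quot_ind: x => f; have [fl f0] := submP f.
rewrite -(linear0 (@quot_pi _ _ (coboundary P (regular_bimodule A) i))); apply/quot_piP.
rewrite subr0; apply/coboundaryE => //; have [van _ _] := coh.
apply: (van _ (theta \o lin_of fl)) => //; exact: (theta_cocycle (submP f)).
Qed.

Lemma tproj_unit : tproj d << 0 : lattice d >> = << 0 >> :> V.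
Proof. by rewrite tprojU; congr (<< _ >>); apply/ffunP => i; rewrite !ffunE if_same. Qed.

(** The class of the lattice point 0, which spans the top Ext. *)
Lemma fundamental_cocycle : exists f : {linear P d -> A^o},
  is_cocycle (P := P) (N := regular_bimodule A) f /\ represents << 0 >> (theta \o f).
Proof.
have [f rf] := represents_total genC gen_shiftC defect_onto P << 0 >> (leqnn d).
have [_ Wf f0] := represents_cocycle rf.
have [h hE] := theta_factor Wf; exists h; split; last first.
  by apply: represents_ext rf => p; rewrite -[RHS]/(theta (h p)) hE.
split=> [|y]; first exact: linearP.
by apply: theta_inj; rewrite hE f0; exact/esym/(linear0 theta).
Qed.

Lemma fundamental_nontrivial (f : {linear P d -> A^o}) :
  represents << 0 >> (theta \o f) -> ~ is_coboundary (P := P) (N := regular_bimodule A) f.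
Proof.
move=> rf /(coboundaryE (linearP f)) cf; have [_ _ cob] := coh.
have := (cob _ (theta \o f) rf).1 cf.
by rewrite tproj_unit => /eqP; rewrite monalgU_eq0 oner_eq0.
Qed.

Lemma cocycle_represents (f : subm (cocycle P (regular_bimodule A) d)) :
  exists v, represents v (theta \o (val f : P d -> A^o)).
Proof.
have [fl _] := submP f; have [_ onto _] := coh.
by apply: (onto (theta \o lin_of fl)); exact: (theta_cocycle (submP f)).
Qed.

Lemma val_cocycleP (c : k) (f g : subm (cocycle P (regular_bimodule A) d)) p :
  theta (val (c *: f + g) p) = c%:A *: theta (val f p) + theta (val g p).
Proof. by rewrite (congr1 (@^~ p) (linearP val c f g)) restr_funE linearP. Qed.

Lemma represents_cobound (f : subm (cocycle P (regular_bimodule A) d)) v :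
  represents v (theta \o (val f : P d -> A^o)) -> tproj d v = 0 ->
  quot_pi (coboundary P (regular_bimodule A) d) f = 0.
Proof.
move=> rf v0; have [fl _] := submP f; have [_ _ cob] := coh.
rewrite -(linear0 (@quot_pi _ _ (coboundary P (regular_bimodule A) d))); apply/quot_piP.
rewrite subr0; apply/(coboundaryE fl); exact/(cob _ (theta \o lin_of fl) rf).
Qed.

Lemma ext_one_dim : one_dimensional (Ext_of P (regular_bimodule A) d).
Proof.
have [f [fc rf]] := fundamental_cocycle.
pose pi := quot_pi (coboundary P (regular_bimodule A) d).
pose c0 := Subm (fc : cocycle P (regular_bimodule A) d f).
exists (pi c0).
  apply/eqP; rewrite -(linear0 pi) => /quot_piP; rewrite subr0.
  exact: fundamental_nontrivial.
elim/quot_ind => g; have [v rg] := cocycle_represents g; have [c cE] := tproj_all v.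
exists c; apply/eqP; rewrite -subr_eq0 addrC -scaleNr -/pi -linearP; apply/eqP.
apply: (@represents_cobound _ (- c *: << 0 >> + v)).
  by apply: represents_ext (represents_linear (- c) rf rg) => p; rewrite [RHS]val_cocycleP.
by rewrite linearP /= cE tproj_unit scaleNr addNr.
Qed.

(** Right multiplication by [a] is [premul a] on equivariant functions, since
    pi (y n a) = pi (a y n). *)
Lemma ext_ract_eps (x : Ext_of P (regular_bimodule A) d) a :
  Ext_ract x a = (eps a : k) *: x.
Proof.
elim/quot_ind: x => f; have [v rf] := cocycle_represents f.
rewrite Ext_ract_pi; apply/eqP; rewrite -subr_eq0 addrC -scaleNr -linearP; apply/eqP.
apply: (@represents_cobound _ (- (eps a : k) *: v + (eps a : k) *: v)); last first.
  by rewrite scaleNr addNr linear0.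
apply: represents_ext (represents_linear (- (eps a : k)) rf (represents_premul genC a rf)) => p.
rewrite [RHS]val_cocycleP; congr (_ + _).
by apply: coindP => y; rewrite apE !thetaE -mulrA -lattice_partC mulrA.
Qed.

End Resolution.
(** The lower bound comes from the fundamental cocycle: injective dimension [n]
    makes every cocycle in a degree larger than [n] a coboundary. *)
Lemma regular_inj_dim : inj_dim_is (A^o : lmodType A) d.
Proof.
have [th thE] : exists th : {linear A^o -> subm (equivariant_sub gen gen_shift d)},
    forall n, val (th n) = theta n.
  apply: (factor_inj (i := (val : {linear subm (equivariant_sub gen gen_shift d) -> _})) (f := theta)).
    exact: val_inj.
  by move=> n; exists (Subm (theta_equivariant n : equivariant_sub gen gen_shift d _)).
split.
  apply/coresolvable_inj_dim_le/(@coresolvable_iso _ _ _ _ th); last first.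
  - exact: (equivariant_coresolvable genC gen_shiftC defect_onto (leqnn d)).
  - move=> f; have [n nE] := theta_onto (submP f).
    by exists n; apply: val_inj; rewrite thE.
  - by move=> n n'  /(congr1 val); rewrite !thE; exact: theta_inj.
move=> n /inj_dim_le_coresolvable idn; pose P := free_resolution (trivial_module eps).
have bound i (f : {linear P i -> A^o}) :
    is_cocycle (P := P) (N := regular_bimodule A) f ->
    ~ is_coboundary (P := P) (N := regular_bimodule A) f -> (i <= n)%N.
  case: i f => // i f [_ f0] ncob; rewrite ltnNge; apply/negP => ni; apply: ncob.
  have [h hE] := coresolvable_ext_vanish idn ni f0.
  by exists h; [exact: linearP | apply/funext].
have [f [fc rf]] := fundamental_cocycle P.
exact: bound fc (fundamental_nontrivial rf).
Qed.

Theorem group_like_Gorenstein : left_AS_Gorenstein eps d /\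
  forall (x : Ext d (trivial_module eps) (regular_bimodule A)) a,
    Ext_ract x a = (eps a : k) *: x.
Proof.
split; last exact: ext_ract_eps.
split; [exact: regular_inj_dim | move=> i id_ x; exact: ext_vanish | exact: ext_one_dim].
Qed.

End Gorenstein.
End GroupLike.

(** * A central lattice of finite index *)

(** The center is written additively, so that integer combinations of central
    elements are available. *)
Section Center.
Variable G : groupType.

Lemma central1 : central (1 : G)%g.
Proof. by move=> g; apply/commute_sym/commute1. Qed.
Lemma centralM (x y : G) : central x -> central y -> central (x * y)%g.
Proof.
by move=> cx cy g; apply/commute_sym/commuteM; apply/commute_sym.
Qed.
Lemma centralV (x : G) : central x -> central x^-1%g.
Proof. by move=> cx g; apply/commute_sym/commuteV/commute_sym. Qed.

Definition center : Type := {g : G | `[< central g >]}.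
HB.instance Definition _ := SubType.on center.
HB.instance Definition _ := [Choice of center by <:].

Lemma centerP (x : center) : central (val x).
Proof. exact/asboolP/(valP x). Qed.
Definition mkcenter (g : G) (gC : central g) : center :=
  exist _ g (introT (asboolP (central g)) gC).

Definition center_add (x y : center) := mkcenter (centralM (centerP x) (centerP y)).
Definition center_opp (x : center) := mkcenter (centralV (centerP x)).
Definition center_zero := mkcenter central1.

Fact center_addA : associative center_add.
Proof. by move=> x y z; apply: val_inj; exact: mulgA. Qed.
Fact center_addC : commutative center_add.
Proof. by move=> x y; apply: val_inj; exact: centerP. Qed.
Fact center_add0 : left_id center_zero center_add.
Proof. by move=> x; apply: val_inj; exact: mul1g. Qed.
Fact center_addN : left_inverse center_zero center_opp center_add.
Proof. by move=> x; apply: val_inj; exact: mulVg. Qed.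
HB.instance Definition _ := GRing.isZmodule.Build center
  center_addA center_addC center_add0 center_addN.

Lemma center_valD (x y : center) : val (x + y) = (val x * val y)%g.
Proof. by []. Qed.

Definition comb m (z : 'I_m -> center) (a : lattice m) : center :=
  \sum_(i < m) z i *~ a i.

Lemma combD m (z : 'I_m -> center) a b : comb z (a + b) = comb z a + comb z b.
Proof.
by rewrite /comb -big_split; apply: eq_bigr => i _; rewrite ffunE mulrzDr.
Qed.

Lemma combMz m (z : 'I_m -> center) a n : comb z (a *~ n) = comb z a *~ n.
Proof.
by rewrite /comb mulrz_suml; apply: eq_bigr => i _; rewrite ffunMzE mulrzz mulrzA.
Qed.

Lemma comb_unit m (z : 'I_m -> center) (i : 'I_m) : comb z (unit_vec m i) = z i.
Proof.
rewrite /comb (bigD1 i) //= big1 => [|l li]; first by rewrite ffunE eqxx addr0.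
by rewrite ffunE [_ == _](negPf li).
Qed.

Definition cofinite m (z : 'I_m -> center) : Prop :=
  exists s : seq G, forall g, exists2 r, r \in s &
    exists a, g = (val (comb z a) * r)%g.

(** Schreier's argument.  For a transversal [T] of the center, [dec] splits each
    element as c r with c central and r in [T].  The factors c of the products
    x r, for x a generator or the inverse of one, together with that of 1,
    generate a subgroup of the center whose products with [T] are all of G. *)
Lemma cofinite_generators : finitely_generated G -> central_by_finite G ->
  exists m (z : 'I_m -> center), cofinite z.
Proof.
move=> [gens gensP] [T TP].
have decomp g : exists rc : G * center, rc.1 \in T /\ g = (val rc.2 * rc.1)%g.
  have [r rT rC] := TP g; exists (r, mkcenter rC); split=> //=.
  by rewrite rC mulVKg.
have {decomp} [dec decP] := choice decomp.
pose xs := gens ++ [seq x^-1%g | x <- gens].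
pose C := (dec 1%g).2 :: [seq (dec (x * r)%g).2 | x <- xs, r <- T].
pose z (i : 'I_(size C)) := C`_i.
exists (size C), z; exists T.
have zC c : c \in C -> exists a, comb z a = c.
  move=> cC; rewrite -index_mem in cC; exists (unit_vec _ (Ordinal cC)).
  by rewrite comb_unit /z nth_index // -index_mem.
pose S g := exists2 r, r \in T & exists a, g = (val (comb z a) * r)%g.
have S1 : S 1%g.
  have [rT rE] := decP 1%g; exists (dec 1%g).1 => //.
  have [|a aE] := zC (dec 1%g).2; first exact: mem_head.
  by exists a; rewrite aE.
have Sx x g : x \in xs -> S g -> S (x * g)%g.
  move=> xxs [r rT [a ->]]; have [rT' rE] := decP (x * r)%g.
  exists (dec (x * r)%g).1 => //.
  have [|b bE] := zC (dec (x * r)%g).2.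
    by rewrite inE; apply/orP; right; apply/allpairsP; exists (x, r).
  exists (a + b); rewrite combD center_valD bE -mulgA -rE !mulgA.
  by rewrite (centerP (comb z a) x).
(* The covered set [S] need not be a subgroup, but its stabiliser is one. *)
pose St : {pred G} := fun h => `[< forall g, S g -> S (h * g)%g /\ S (h^-1 * g)%g >].
have StP h : h \in St -> forall g, S g -> S (h * g)%g /\ S (h^-1 * g)%g.
  by move=> /asboolP.
move=> g; suff : g \in St by move=> /StP/(_ _ S1)[]; rewrite mulg1.
apply: gensP.
  split; first by apply/asboolP => h Sh; rewrite invg1 mul1g.
  move=> x y xS yS; apply/asboolP => h Sh; rewrite invgM invgK -!mulgA.
  split; first by apply: (StP x xS _ _).1; exact: (StP y yS _ _).2.
  by apply: (StP y yS _ _).1; exact: (StP x xS _ _).2.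
move=> x xg; apply/asboolP => h Sh; split; apply: Sx => //.
  by rewrite mem_cat xg.
by rewrite mem_cat map_f ?orbT.
Qed.

(** A relation in which [z i] occurs makes [z i] superfluous up to finite index:
    divide the exponent of [z i] by [a i] and absorb the remainder in the finite
    set of representatives. *)
Lemma cofinite_drop m (z : 'I_m.+1 -> center) a i :
  cofinite z -> comb z a = 0 -> a i != 0 -> cofinite (z \o lift i).
Proof.
move=> [s sP] za ai.
exists [seq (val (z i *+ t) * r)%g | t <- iota 0 (absz (a i)), r <- s] => g.
have [r rs [b ->]] := sP g.
pose c := b - a *~ (b i %/ a i)%Z.
have cE : c i = (b i %% a i)%Z.
  by rewrite !ffunE ffunMzE mulrzz mulrC /modz.
have t_lt : (absz (c i) < absz (a i))%N.
  by rewrite -ltz_nat gez0_abs ?cE ?modz_ge0 // abszE ltz_mod.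
exists (val (z i *+ absz (c i)) * r)%g.
  by apply/allpairsP; exists (absz (c i), r); rewrite mem_iota.
exists [ffun l => c (lift i l)].
rewrite mulgA -center_valD; congr (val _ * _)%g.
have -> : comb z b = comb z c.
  by rewrite /c combD -mulrNz combMz za mul0rz addr0.
rewrite /comb (bigD1_ord i) //= addrC; congr (_ + _).
  by apply: eq_bigr => l _; rewrite [in RHS]ffunE.
by rewrite pmulrn gez0_abs // cE modz_ge0.
Qed.

(** Among families of central elements that generate a subgroup of finite index,
    drop members that occur in a relation until no relation is left. *)
Theorem central_lattice : finitely_generated G -> central_by_finite G ->
  exists d (alpha : lattice d -> G),
    [/\ forall a b, alpha (a + b) = (alpha a * alpha b)%g, injective alpha,
        forall a, central (alpha a)
      & exists s : seq G, forall g, exists2 r, r \in s & exists a, g = (alpha a * r)%g].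
Proof.
move=> fgG cfG; have [m [z zP]] := cofinite_generators fgG cfG.
elim: m z zP => [|m IHm] z zP.
  exists 0%N, (fun a => val (comb z a)); split=> //.
  - by move=> a b; rewrite combD.
  - by move=> a b _; apply/ffunP => -[].
  - by move=> a; exact: centerP.
have [[a za]|z_free] := pselect (exists2 a, comb z a = 0 & a != 0).
  move=> a0; have [i ai] : exists i, a i != 0.
    apply/existsP; rewrite -negb_forall; apply: contra a0 => /forallP a0.
    by apply/eqP/ffunP => i; rewrite ffunE; apply/eqP.
  exact: IHm (cofinite_drop zP za ai).
exists m.+1, (fun a => val (comb z a)); split=> //.
- by move=> a b; rewrite combD.
- move=> a b /val_inj ab; apply/eqP; rewrite -subr_eq0; apply: contraT => ab0.
  case: z_free; exists (a - b) => //.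
  by rewrite combD -mulrN1z combMz mulrN1z ab subrr.
- by move=> a; exact: centerP.
Qed.

End Center.

(** * The integral order of a group algebra *)

Lemma integral_order1 (k : fieldType) (H : hopfAlgebra k) (d : nat) :
  one_dimensional (Ext d (trivial_module (counit H)) (regular_bimodule H)) ->
  (forall (x : Ext d (trivial_module (counit H)) (regular_bimodule H)) a,
    Ext_ract x a = (counit H a : k) *: x) ->
  integral_order H d = Some 1%N.
Proof.
move=> [e e0 eP] xa.
have iso1 : trivial_power H d 1.
  have [c cP] := choice eP.
  have cE t x : x = t *: e -> c x = t.
    move=> xE; apply/eqP; rewrite -subr_eq0.
    have /eqP : (c x - t) *: e = 0 by rewrite scalerBl -cP xE subrr.
    by rewrite scaler_eq0 (negPf e0) orbF.
  have cl : linear (c : left_integral (counit H) d -> trivial_bimodule (counit H)).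
    move=> a x y; apply: cE; rewrite trivZ trivZ {1}(cP x) {1}(cP y).
    by rewrite scalerDl scalerA.
  exists (lin_of cl); split=> [|x a] /=.
    exists (fun t : k => t *: e) => t; first exact/esym/cP.
    exact: cE.
  by apply: cE; rewrite xa {1}(cP x) scalerA.
rewrite /integral_order; case: pselect => [ex|[]]; last first.
  by exists 1%N; apply/asboolP.
case: ex_minnP => n /andP[n0 _] /(_ 1%N); rewrite /=.
by move=> /(_ (introT (asboolP _) iso1)) n1; congr Some; apply/eqP; rewrite eqn_leq n1.
Qed.

Section GroupAlgebraBases.
Variables (k : fieldType) (G : groupType).
Local Notation A := (grpalg k G).

Lemma flift_grp_elt (x : A) : flift (@grp_elt k G) x = x.
Proof.
apply: (free_ext (f := flift (@grp_elt k G)) (g := idfun)) => g /=.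
exact: ga_fliftE.
Qed.

(** The basis of the opposite algebra that multiplies as [G]; its coordinates are
    given by the antipode. *)
Definition conv_elt (g : G) : A^c := grp_elt k g^-1%g.

Lemma conv_eltM g h : conv_elt g * conv_elt h = conv_elt (g * h)%g.
Proof.
by rewrite -[LHS]/(grp_elt k h^-1%g * grp_elt k g^-1%g) grp_eltM -invgM.
Qed.

Fact conv_coord_linear : linear (@ga_antipode k G : A^c -> {malg k[G]}).
Proof. exact: ga_flift_linear. Qed.

Lemma conv_coordK : cancel (lin_of conv_coord_linear) (flift conv_elt).
Proof.
have fl : linear (fun x : A => flift conv_elt (ga_antipode x) : A).
  move=> a x y; rewrite [X in flift _ X](ga_flift_linear _ a x y).
  exact: (linearP (flift conv_elt)).
have il : linear (fun x : A => x) by [].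
move=> x; apply: (ga_ext fl il) => g.
by rewrite ga_antipodeE /grp_elt fliftU scale1r /conv_elt invgK.
Qed.

Lemma conv_coord_e g : lin_of conv_coord_linear (conv_elt g) = << g >>.
Proof. by rewrite -[LHS]/(ga_antipode (grp_elt k g^-1%g)) ga_antipodeE invgK. Qed.

End GroupAlgebraBases.

Theorem proposition2p16 (k : fieldType) (G : groupType) :
  finitely_generated G -> central_by_finite G ->
  exists d : nat, AS_Gorenstein (group_algebra k G) d /\
    integral_order (group_algebra k G) d = Some 1%N.
Proof.
move=> fgG cfG; have [d [alpha [aD ainj aC [reps repsP]]]] := central_lattice fgG cfG.
have [left_G ract] := group_like_Gorenstein (e := @grp_elt k G) (@grp_eltM k G) erefl
  (coord := idfun) (@flift_grp_elt k G) (fun=> erefl) aD ainj aC repsP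
  (eps := counit (group_algebra k G)) (@ga_counitE k G).
have conv1 : conv_elt k (1%g : G) = 1 by rewrite /conv_elt invg1.
have [right_G _] := group_like_Gorenstein (@conv_eltM k G) conv1
  (@conv_coordK k G) (@conv_coord_e k G) aD ainj aC repsP
  (eps := conv_eps (counit (group_algebra k G))) (fun g => ga_counitE k g^-1%g).
exists d; split; first by split.
by apply: integral_order1 => //; case: left_G.
Qed.
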